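(* Let $G$ be a finitely generated nilpotent group and let $(\pi,V)$ be an irreducible complex representation of $G$ whose underlying vector space $V$ has countable dimension. Then $\pi$ is monomial if and only if $\pi$ has finite weight.
   Context: Representations are algebraic: a representation $(\pi,V)$ of a (discrete) group $G$ is a homomorphism $\pi: G\to \mathrm{Aut}(V)$ with $V$ a complex vector space, possibly infinite dimensional; irreducible means that $V \neq 0$ has no proper nonzero $G$-invariant subspace. A character of a group $H$ is a homomorphism $\chi: H\to\mathbb{C}^{\times}$. For a subgroup $H$ of $G$ and a character $\chi$ of $H$, the (finitely) induced representation $\mathrm{Ind}_H^G(\chi)$ is the space of functions $f: G\to\mathbb{C}$ such that $f(hg)=\chi(h)f(g)$ for all $h\in H$, $g\in G$, and such that the support of $f$ is contained in a union of finitely many right cosets $Hg$ of $H$ in $G$; $G$ acts by $(g\cdot f)(x)=f(xg)$. Equivalently, it is $\mathbb{C}[G]\otimes_{\mathbb{C}[H]}\mathbb{C}_\chi$. A representation $\pi$ of $G$ is monomial if $\pi\cong \mathrm{Ind}_H^G(\chi)$ for some subgroup $H$ of $G$ and some character $\chi$ of $H$. A representation $(\pi,V)$ of $G$ has finite weight if there exist a subgroup $H$ of $G$ and a character $\chi: H\to\mathbb{C}^\times$ such that the space $V_H(\chi)=\{v\in V \mid \pi(h)v=\chi(h)v \text{ for all } h\in H\}$ is non-zero and finite dimensional. *)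

(* Defs.v *)
From HB Require Import structures.
From mathcomp Require Import all_boot all_order all_algebra.
From mathcomp Require Import boolp classical_sets functions cardinality reals.
From mathcomp.real_closed Require Import complex.

Set Implicit Arguments.
Unset Strict Implicit.
Unset Printing Implicit Defensive.

Import GRing.Theory.

Local Open Scope classical_set_scope.
Local Open Scope ring_scope.

Section Groups.
Variable G : groupType.
Implicit Types (H S : set G).

Definition is_subgroup H : Prop := group_closed (mem H).

Definition subgroup_gen S : set G := smallest is_subgroup S.

Definition finitely_generated : Prop :=
  exists S : set G, finite_set S /\ subgroup_gen S = setT.

Fixpoint lower_central (n : nat) : set G :=
  if n is m.+1 then
    subgroup_gen [set commg x y | x in lower_central m & y in setT]
  else setT.

Definition nilpotent_group : Prop :=
  exists n : nat, lower_central n = [set 1%g].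

Definition right_coset H (g : G) : set G := [set (h * g)%g | h in H].

End Groups.

Section LinearAlgebra.
Variables (K : fieldType) (V : lmodType K).
Implicit Types (B W : set V).

Definition is_subspace W : Prop := submod_closed (mem W).

Definition lin_span B : set V := smallest is_subspace B.

Definition lin_independent B : Prop :=
  forall (s : seq V) (a : V -> K), uniq s -> {in s, forall v, B v} ->
    \sum_(v <- s) a v *: v = 0 -> {in s, forall v, a v = 0}.

Definition is_basis B W : Prop := lin_independent B /\ lin_span B = W.

Definition finite_dimensional W : Prop :=
  exists B, finite_set B /\ is_basis B W.

(* [countable] means at most countable, so finite dimension is included. *)
Definition countable_dimensional W : Prop :=
  exists B, countable B /\ is_basis B W.

End LinearAlgebra.

(* Each [repr_fun g] is invertible, with inverse [repr_fun g^-1]. *)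
Record representation (K : fieldType) (G : groupType) (V : lmodType K) :=
  Representation {
    repr_fun :> G -> {linear V -> V};
    repr_fun1 : forall v, repr_fun 1%g v = v;
    repr_funM : forall g h v, repr_fun (g * h)%g v = repr_fun g (repr_fun h v)
  }.

Section Representations.
Variables (K : fieldType) (G : groupType).

Definition irreducible (V : lmodType K) (pi : representation G V) : Prop :=
  (exists v : V, v != 0) /\
  forall W : set V, is_subspace W -> (forall g v, W v -> W (pi g v)) ->
    W = [set 0] \/ W = setT.

Definition isomorphic (V W : lmodType K)
    (pi : representation G V) (rho : representation G W) : Prop :=
  exists phi : {linear V -> W},
    bijective phi /\ forall g v, phi (pi g v) = rho g (phi v).

(* A character of a subgroup [H] is carried by a function on all of [G]; its
   values outside [H] are irrelevant. *)
Definition is_character (H : set G) (chi : G -> K) : Prop :=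
  (forall h, H h -> chi h != 0) /\
  (forall h k, H h -> H k -> chi (h * k)%g = chi h * chi k).

Definition weight_space (V : lmodType K) (pi : representation G V)
    (H : set G) (chi : G -> K) : set V :=
  [set v | forall h, H h -> pi h v = chi h *: v].

Definition finite_weight (V : lmodType K) (pi : representation G V) : Prop :=
  exists (H : set G) (chi : G -> K),
    [/\ is_subgroup H, is_character H chi,
        exists2 v, weight_space pi H chi v & v != 0 &
        finite_dimensional (weight_space pi H chi)].

Section Induced.
Variables (H : set G) (chi : G -> K).

Definition induced_space : set (G -> K^o) :=
  [set f | (forall h g, H h -> f (h * g)%g = chi h * f g) /\
    exists A : set G, finite_set A /\
      [set x | f x != 0] `<=` \bigcup_(g in A) right_coset H g].

Lemma induced_space_submod : GRing.subsemimod_closed (mem induced_space).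
Proof.
split=> [|a f].
  split=> [|f1 f2].
    rewrite inE; split=> [h g _|]; first by rewrite mulr0.
    by exists set0; split=> // x /=; rewrite eqxx.
  rewrite !inE => -[e1 [A1 [fA1 s1]]] [e2 [A2 [fA2 s2]]]; split=> [h g Hh|].
    by rewrite !addrfctE e1// e2// mulrDr.
  exists (A1 `|` A2); split; first by rewrite finite_setU.
  move=> x /=; rewrite addrfctE bigcup_setU.
  have [f1x|f1x _] := eqVneq (f1 x) 0; last by left; exact: s1.
  by rewrite f1x add0r => f2x; right; exact: s2.
rewrite !inE => -[e [A [fA s]]]; split=> [h g Hh|].
  by rewrite !scalrfctE /= e// !scalerAr.
exists A; split=> // x /=; rewrite scalrfctE /= => afx; apply: s => /=.
by apply: contra_neq afx => ->; rewrite scaler0.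
Qed.

Record induced := Induced {
  induced_fun :> G -> K^o;
  induced_funP : induced_fun \in induced_space }.

HB.instance Definition _ := [isSub for induced_fun].
HB.instance Definition _ := [Choice of induced by <:].
HB.instance Definition _ :=
  GRing.SubChoice_isSubLmodule.Build K (G -> K^o) (mem induced_space) induced
    induced_space_submod.

Lemma right_translate_subproof (g : G) (f : induced) :
  (fun x => f (x * g)%g) \in induced_space.
Proof.
have := induced_funP f; rewrite !inE => -[e [A [fA s]]]; split=> [h x Hh|].
  by rewrite -mulgA; exact: e.
exists [set (a * g^-1)%g | a in A]; split; first exact: finite_image.
move=> x /= /s[a Aa [h Hh hax]]; exists (a * g^-1)%g; first by exists a.
by exists h => //; rewrite mulgA hax mulgK.
Qed.

Definition right_translate (g : G) (f : induced) : induced :=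
  Induced (right_translate_subproof g f).

Lemma right_translate_is_linear (g : G) : linear (right_translate g).
Proof. by move=> a f1 f2; apply: val_inj; apply/funext. Qed.

HB.instance Definition _ (g : G) :=
  GRing.isLinear.Build K induced induced *:%R (right_translate g)
    (right_translate_is_linear g).

Lemma right_translate1 (f : induced) : right_translate 1%g f = f.
Proof. by apply: val_inj; apply/funext => x /=; rewrite mulg1. Qed.

Lemma right_translateM (g h : G) (f : induced) :
  right_translate (g * h)%g f = right_translate g (right_translate h f).
Proof. by apply: val_inj; apply/funext => x /=; rewrite mulgA. Qed.

Definition Ind : representation G induced :=
  @Representation K G induced (fun g => right_translate g)
    right_translate1 right_translateM.

End Induced.

Definition monomial (V : lmodType K) (pi : representation G V) : Prop :=
  exists (H : set G) (chi : G -> K),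
    [/\ is_subgroup H, is_character H chi & isomorphic pi (Ind H chi)].

End Representations.

(* Main.v *)
Require Import Defs.
From HB Require Import structures.
From mathcomp Require Import all_boot all_order all_algebra.
From mathcomp Require Import boolp classical_sets functions cardinality reals.
From mathcomp.real_closed Require Import complex.
From mathcomp Require lebesgue_measure.

(** An irreducible representation [pi] induced from a character [chi] of [H] has
    finite weight because of Schur's lemma, which holds over the complex numbers in
    countable dimension ([schur]). By Frobenius reciprocity the vectors of weight
    [chi] correspond to the endomorphisms of [pi], and these are scalars; so the
    weight space of [chi] is a line ([finite_weight_of_monomial]).

    Conversely let [pi] have finite weight. The notion is first generalized from
    characters to simple modules: a pair of a subgroup [P] and a simple [P]-module [U] in
    [V], of finite dimension, has finite multiplicity if the homomorphisms from [U]
    to [V] form a space of finite dimension. As [G] satisfies the maximal condition on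
    subgroups ([maximal_condition_fg_nilpotent]), such a pair can be chosen with [P]
    maximal. If [g] normalizes [P] and some positive power of [g] carries [U] to an
    isomorphic module, then the translates of the isotypic component of [U] by the
    powers of [g] have a sum of finite dimension, which contains a module of finite
    multiplicity for the group generated by [P] and [g]
    ([finite_multiplicity_extension]); by maximality [g] lies in [P]. In particular
    the quotient by [P] of its normalizer is torsion free, from which it follows that [P]
    is isolated: it contains all elements of [G] having a positive power in it
    ([isolated_of_normalizer]).

    The claim is that [V] is induced from [U]. It is proved along a subnormal series from
    [P] to [G], with the stronger induction hypothesis that the module [W] generated by
    [U] over a term [N] of the series is simple and induced from [U]. By Clifford theory
    the passage to the next term only requires that [W] be not isomorphic to its
    translate by any [g] of this term outside [N]. An isomorphism would map [U]
    into a finite sum of translates of [U] by elements [y] of [g N]. Then [P]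
    permutes finitely many cosets of [P], and because [P] is isolated it follows that such
    a [y] normalizes [P] and carries [U] to an isomorphic module. By the choice of [P] this
    puts [y] in [P], a contradiction ([no_equivariant]).

    Finally [U], being a simple module of finite dimension over a nilpotent group, is
    induced from a character, by the same argument as for finite groups
    ([fin_dim_monomial]), and induction is transitive ([imprimitive_trans]). *)

Set Implicit Arguments.
Unset Strict Implicit.
Unset Printing Implicit Defensive.

Import GRing.Theory.

Local Open Scope classical_set_scope.
Local Open Scope ring_scope.

(** * Subgroups and the lower central series *)

Section SubgroupFacts.
Variable G : groupType.
Implicit Types (H K M P : set G) (x y g : G).
Local Open Scope group_scope.

Lemma is_subgroupP H : is_subgroup H <->
  H 1 /\ forall x y, H x -> H y -> H (x * y^-1).
Proof.
split=> -[H1 HF]; split; first by rewrite inE in H1.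
- by move=> x y Hx Hy; have := HF x y; rewrite !inE; apply.
- by rewrite inE.
- by move=> x y; rewrite !inE; apply: HF.
Qed.

Lemma subgroup1 H : is_subgroup H -> H 1.
Proof. by case/is_subgroupP. Qed.

Lemma subgroupV H x : is_subgroup H -> H x -> H x^-1.
Proof. by case/is_subgroupP=> H1 HF /(HF _ _ H1); rewrite mul1g. Qed.

Lemma subgroupM H x y : is_subgroup H -> H x -> H y -> H (x * y).
Proof.
move=> sH Hx /(subgroupV sH) Hy; case/is_subgroupP: sH => _ HF.
by rewrite -(invgK y); apply: HF.
Qed.

Lemma subgroupX H x n : is_subgroup H -> H x -> H (x ^+ n).
Proof.
move=> sH Hx; elim: n => [|n IHn]; first exact: subgroup1.
by rewrite expgS; apply: subgroupM.
Qed.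

Lemma subgroupJ H x y : is_subgroup H -> H x -> H y -> H (x ^ y).
Proof.
by move=> sH Hx Hy; do 2?[apply: subgroupM => //]; apply: subgroupV.
Qed.

Lemma subgroup_setT : is_subgroup [set: G].
Proof. by apply/is_subgroupP. Qed.

Lemma subgroup_preimV H x : is_subgroup H -> H x^-1 -> H x.
Proof. by move=> sH /(subgroupV sH); rewrite invgK. Qed.

Lemma subgroup_gen_subgroup (S : set G) : is_subgroup (subgroup_gen S).
Proof.
apply/is_subgroupP; split=> [|x y Sx Sy] M [sM SM]; first exact: subgroup1.
by apply: subgroupM (Sx _ _) (subgroupV sM (Sy _ _)).
Qed.

Definition normalizes g P := forall p, P p -> P (p ^ g) /\ P (p ^ g^-1).

Lemma normalizesX g P n : normalizes g P -> normalizes (g ^+ n) P.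
Proof.
move=> nP; elim: n => [|n IHn] p Pp; first by rewrite invg1 conjg1.
split; first by rewrite expgSr conjgM; apply: (nP _ _).1; apply: (IHn _ _).1.
by rewrite expgS invgM conjgM; apply: (nP _ _).2; apply: (IHn _ _).2.
Qed.

Lemma normalizesV g P : normalizes g P -> normalizes g^-1 P.
Proof. by move=> nP p /nP; rewrite invgK; case. Qed.

(** The subgroup generated by [a] and a subgroup [M] which [a] normalizes; two
    natural exponents take the place of one integer exponent. *)
Definition cyclic_extension (a : G) M : set G :=
  [set x | exists k l, M (a ^- k * x * a ^+ l)].

Section CyclicExtension.
Variables (a : G) (M : set G).
Hypotheses (sM : is_subgroup M) (nM : normalizes a M).

Lemma cyclic_extension_sub : M `<=` cyclic_extension a M.
Proof. by move=> x Mx; exists 0%N, 0%N; rewrite invg1 mul1g mulg1. Qed.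

Lemma cyclic_extension_mem : cyclic_extension a M a.
Proof. by exists 1%N, 0%N; rewrite mulVg mul1g; apply: (subgroup1 sM). Qed.

Lemma cyclic_extension_subgroup : is_subgroup (cyclic_extension a M).
Proof.
apply/is_subgroupP; split; first exact: cyclic_extension_sub (subgroup1 sM).
move=> x y [k [l Mx]] [k' [l' My]]; exists (k + l')%N, (k' + l)%N.
have Ex : x = a ^+ k * (a ^- k * x * a ^+ l) * a ^- l by rewrite mulgA mulVKg mulgK.
have Ey : y = a ^+ k' * (a ^- k' * y * a ^+ l') * a ^- l'.
  by rewrite mulgA mulVKg mulgK.
move: Ex Ey Mx My; move: (_ * _ * a ^+ l) (_ * _ * a ^+ l') => m m' -> -> Mm Mm'.
have -> : a ^- (k + l') * ((a ^+ k * m * a ^- l) * (a ^+ k' * m' * a ^- l')^-1) *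
    a ^+ (k' + l) = m ^ (a ^+ l') * m'^-1 ^ (a ^+ l).
  rewrite !conjgE !expgnDr !gnorm.
  congr (_ * _ * _); rewrite -!(mulgA (_ * m)); congr (_ * _).
  by apply/commute_sym/commuteV/commuteX2.
apply: subgroupM => //; first exact: (normalizesX _ nM Mm).1.
exact: (normalizesX _ nM (subgroupV sM Mm')).1.
Qed.

Lemma cyclic_extensionP x : cyclic_extension a M x ->
  exists k, M (a ^- k * x) \/ M (a ^- k * x^-1).
Proof.
move=> [k [l Mx]]; set m := a ^- k * x * a ^+ l in Mx.
have [lk|kl] := leqP l k.
  exists (k - l)%N; left.
  have -> : a ^- (k - l) * x = m ^ (a ^- l).
    rewrite expgnFr// conjgE /m invgM !invgK !mulgA mulgK; congr (_ * _ * _).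
  exact: (normalizesX _ nM Mx).2.
exists (l - k)%N; right.
have -> : a ^- (l - k) * x^-1 = m^-1 ^ (a ^- k).
  rewrite expgnFr 1?ltnW// conjgE /m !invgM !invgK !mulgA mulgK; congr (_ * _).
exact: (normalizesX _ nM (subgroupV sM Mx)).2.
Qed.

Lemma cyclic_extension_min H : is_subgroup H -> M `<=` H -> H a ->
  cyclic_extension a M `<=` H.
Proof.
move=> sH MH Ha x /cyclic_extensionP[k].
have Hk : H (a ^+ k) by apply: subgroupX.
case=> /MH /(subgroupM sH Hk); rewrite mulVKg//.
by move=> /(subgroupV sH); rewrite invgK.
Qed.

End CyclicExtension.

(** The lower central series of the subgroup [Q]; the isolator argument needs
    it for subgroups other than the whole group. *)
Fixpoint lcs (Q : set G) n : set G :=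
  if n is m.+1 then subgroup_gen [set commg x y | x in lcs Q m & y in Q] else Q.

Lemma lower_central_lcs n : @lower_central G n = lcs setT n.
Proof. by elim: n => //= n ->. Qed.

Section LowerCentral.
Variable Q : set G.
Hypothesis sQ : is_subgroup Q.

Lemma lcs_subgroup n : is_subgroup (lcs Q n).
Proof. by case: n => [|n] //; exact: subgroup_gen_subgroup. Qed.

Lemma lcs_lower_central n : lcs Q n `<=` @lower_central G n.
Proof.
elim: n => [|n IHn] //; apply: smallest_sub.
  rewrite lower_central_lcs; case: n {IHn} => [|n]; exact: subgroup_gen_subgroup.
move=> _ [a Ha [b _ <-]]; apply: sub_gen_smallest.
by exists a; [exact: IHn|exists b].
Qed.

Lemma lcs_commg n x y : lcs Q n x -> Q y -> lcs Q n.+1 [~ x, y].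
Proof. by move=> nx Qy; apply: sub_gen_smallest; exists x => //; exists y. Qed.

Lemma lcsJ n x y : lcs Q n x -> Q y -> lcs Q n (x ^ y).
Proof.
elim: n x y => [|n IHn] x y; first exact: subgroupJ.
have sN := lcs_subgroup n.+1.
move=> /(_ [set z | forall y, Q y -> lcs Q n.+1 (z ^ y)]) + Qy; apply => //.
split.
  apply/is_subgroupP; split=> [z _|u v Hu Hv z Qz].
    by rewrite conj1g; apply: (subgroup1 sN).
  rewrite conjMg conjVg.
  by apply: (subgroupM sN); [exact: Hu|apply: (subgroupV sN); exact: Hv].
move=> _ [a Ha [b Qb <-]] z Qz; rewrite conjRg.
by apply: lcs_commg; [exact: IHn|exact: subgroupJ].
Qed.

Lemma lcsS n : lcs Q n.+1 `<=` lcs Q n.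
Proof.
have sN := lcs_subgroup n.
apply: smallest_sub => // _ [a Ha [b Qb <-]]; rewrite commgEl.
by apply: (subgroupM sN (subgroupV sN Ha)); apply: lcsJ.
Qed.

Lemma lcs_sub n : lcs Q n `<=` Q.
Proof. by elim: n => [|n IHn] // x /lcsS /IHn. Qed.

Lemma lcs_normalizes n M g : is_subgroup M -> Q g ->
  M `<=` lcs Q n -> lcs Q n.+1 `<=` M -> normalizes g M.
Proof.
move=> sM Qg Mn nM p Mp.
have MJ h : Q h -> M (p ^ h).
  move=> Qh; have -> : p ^ h = p * [~ p, h] by rewrite commgEl mulVKg.
  by apply: (subgroupM sM) => //; apply: nM; apply: lcs_commg => //; apply: Mn.
by split; apply: MJ => //; apply: subgroupV.
Qed.

Definition generates_layer n (A : set G) := A `<=` lcs Q n /\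
  forall M, is_subgroup M -> lcs Q n.+1 `<=` M -> A `<=` M -> lcs Q n `<=` M.

(** The commutator is biadditive modulo the next layer, so the commutators of
    generators generate. *)
Lemma generates_layerS n S A : subgroup_gen S = Q -> generates_layer n A ->
  generates_layer n.+1 [set commg a s | a in A & s in S].
Proof.
move=> genS [An genA].
have SQ : S `<=` Q by rewrite -genS; exact: sub_gen_smallest.
split.
  by move=> _ [a Aa [s Ss <-]]; apply: lcs_commg; [exact: An|exact: SQ].
move=> M sM nM AM; have sN := lcs_subgroup n; have sN1 := lcs_subgroup n.+1.
have MJ c z : lcs Q n.+1 c -> Q z -> M c -> M (c ^ z).
  move=> nc Qz Mc; have -> : c ^ z = c * [~ c, z] by rewrite commgEl mulVKg.
  by apply: (subgroupM sM) => //; apply: nM; apply: lcs_commg.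
have MJV c z : lcs Q n.+1 c -> Q z -> M (c ^ z) -> M c.
  move=> nc Qz Mcz; rewrite -(conjgK z c); apply: MJ => //; first exact: lcsJ.
  exact: subgroupV.
pose L : set G := [set x | lcs Q n x /\ forall y, Q y -> M [~ x, y]].
have sL : is_subgroup L.
  apply/is_subgroupP; split.
    split=> [|y _]; first exact: subgroup1.
    by rewrite comm1g; apply: (subgroup1 sM).
  move=> x y [nx Mx] [ny My]; split; first exact: (subgroupM sN nx (subgroupV sN ny)).
  move=> z Qz.
  have -> : [~ x * y^-1, z] = ([~ x, z] * [~ y, z]^-1) ^ y^-1.
    by rewrite !commgEl !conjgE !gnorm.
  apply: MJ; last by apply: (subgroupM sM (Mx z Qz)); apply: subgroupV => //; apply: My.
    by apply: (subgroupM sN1); last apply: (subgroupV sN1); apply: lcs_commg.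
  by apply: subgroupV => //; apply: lcs_sub ny.
suff AL : A `<=` L.
  have nL : lcs Q n `<=` L.
    apply: genA => // x Nx; split; first exact: lcsS.
    by move=> y Qy; apply: nM; apply: lcs_commg.
  by apply: smallest_sub => // _ [x nx [y Qy <-]]; apply: (nL x nx).2.
move=> a Aa; split; first exact: An.
pose B : set G := [set y | Q y /\ M [~ a, y]].
suff QB : Q `<=` B by move=> y /QB[].
have nC y : Q y -> lcs Q n.+1 [~ a, y] by apply: lcs_commg; apply: An.
rewrite -{1}genS; apply: smallest_sub; last first.
  by move=> s Ss; split; [exact: SQ|apply: AM; exists a => //; exists s].
apply/is_subgroupP; split.
  by split; [exact: subgroup1|rewrite commg1; apply: subgroup1].
move=> x y [Qx Bx] [Qy By]; have QF := subgroupM sQ Qx (subgroupV sQ Qy).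
split=> //; apply: (MJV _ y (nC _ QF) Qy).
have -> : [~ a, x * y^-1] ^ y = [~ a, y]^-1 * [~ a, x].
  by rewrite !commgEl !conjgE !gnorm.
exact: (subgroupM sM (subgroupV sM By) Bx).
Qed.

Definition lcs_cong n x y := lcs Q n (y^-1 * x).

Lemma lcs_cong_trans n x y z : lcs_cong n x y -> lcs_cong n y z -> lcs_cong n x z.
Proof.
move=> xy yz; have := subgroupM (lcs_subgroup n) yz xy.
by rewrite /lcs_cong mulgA mulgK.
Qed.

Lemma lcs_cong_sym n x y : lcs_cong n x y -> lcs_cong n y x.
Proof.
by move=> /(subgroupV (lcs_subgroup n)); rewrite /lcs_cong invgM invgK.
Qed.

Lemma lcs_congM n x y x' y' : Q y' ->
  lcs_cong n x y -> lcs_cong n x' y' -> lcs_cong n (x * x') (y * y').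
Proof.
move=> Qy' xy xy'; rewrite /lcs_cong.
have -> : (y * y')^-1 * (x * x') = (y^-1 * x) ^ y' * (y'^-1 * x').
  by rewrite conjgE !gnorm.
by apply: (subgroupM (lcs_subgroup n)) => //; apply: lcsJ.
Qed.

Lemma lcs_congX n x y k : Q y -> lcs_cong n x y -> lcs_cong n (x ^+ k) (y ^+ k).
Proof.
move=> Qy xy; elim: k => [|k IHk].
  by rewrite /lcs_cong mulVg; apply: (subgroup1 (lcs_subgroup n)).
by rewrite !expgS; apply: lcs_congM => //; apply: subgroupX.
Qed.

Lemma lcs_cong_commMl n a a' b : lcs Q n a -> lcs Q n a' -> Q b ->
  lcs_cong n.+2 [~ a * a', b] ([~ a, b] * [~ a', b]).
Proof.
move=> na na' Qb; rewrite /lcs_cong.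
have -> : ([~ a, b] * [~ a', b])^-1 * [~ a * a', b] =
    [~ [~ a, b], a'] ^ [~ a', b] by rewrite !commgEl !conjgE !gnorm.
have Qa' := lcs_sub na'.
apply: lcsJ; first by do 2?[apply: lcs_commg].
by rewrite commgEl; apply: (subgroupM sQ (subgroupV sQ Qa')); apply: subgroupJ.
Qed.

Lemma lcs_cong_commMr n a b b' : lcs Q n a -> Q b -> Q b' ->
  lcs_cong n.+2 [~ a, b * b'] ([~ a, b'] * [~ a, b]).
Proof.
move=> na Qb Qb'; rewrite /lcs_cong.
have -> : ([~ a, b'] * [~ a, b])^-1 * [~ a, b * b'] = [~ [~ a, b], b'].
  by rewrite !commgEl !conjgE !gnorm.
by do 2?[apply: lcs_commg].
Qed.

Lemma lcs_cong_commXl n a b k : lcs Q n a -> Q b ->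
  lcs_cong n.+2 [~ a ^+ k, b] ([~ a, b] ^+ k).
Proof.
move=> na Qb; have Qab : Q [~ a, b] by apply: (@lcs_sub n.+1); apply: lcs_commg.
elim: k => [|k IHk].
  by rewrite /lcs_cong comm1g mulVg; apply: (subgroup1 (lcs_subgroup n.+2)).
rewrite !expgS; apply: lcs_cong_trans (lcs_cong_commMl na _ Qb) _.
  exact: (subgroupX _ (lcs_subgroup n)).
apply: lcs_congM => //; first exact: subgroupX.
by rewrite /lcs_cong mulVg; apply: (subgroup1 (lcs_subgroup n.+2)).
Qed.

Lemma lcs_cong_commXr n a b k : lcs Q n a -> Q b ->
  lcs_cong n.+2 [~ a, b ^+ k] ([~ a, b] ^+ k).
Proof.
move=> na Qb; have Qab : Q [~ a, b] by apply: (@lcs_sub n.+1); apply: lcs_commg.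
elim: k => [|k IHk].
  by rewrite /lcs_cong commg1 mulVg; apply: (subgroup1 (lcs_subgroup n.+2)).
rewrite expgSr expgS; apply: lcs_cong_trans (lcs_cong_commMr na _ Qb) _.
  exact: subgroupX.
apply: lcs_congM => //; first exact: subgroupX.
by rewrite /lcs_cong mulVg; apply: (subgroup1 (lcs_subgroup n.+2)).
Qed.

End LowerCentral.

Lemma generates_layer0 S : generates_layer (subgroup_gen S) 0 S.
Proof.
split; first exact: sub_gen_smallest.
by move=> M sM _ SM; apply: smallest_sub.
Qed.

(** * Subgroups of a finitely generated nilpotent group *)

(** Relative to [M], so that it can be proved along a series of subgroups; for
    [M = setT] it is the usual maximal condition on subgroups. *)
Definition maximal_condition (M : set G) := forall F : set (set G),
  (exists P, F P) -> (forall P, F P -> is_subgroup P) ->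
  exists2 P, F P & forall P', F P' -> P `<=` P' -> P' `&` M `<=` P.

(** Start from a member of the family that meets [a ^+ n * M] for the least [n > 0]
    occurring in the family. Division with remainder shows that a larger member
    meets [a ^+ k * M] only when [n] divides [k], so that what it has outside [M] is
    already determined by what it has inside. *)
Lemma maximal_condition_cyclic a M : is_subgroup M -> (forall g, normalizes g M) ->
  maximal_condition M -> maximal_condition (cyclic_extension a M).
Proof.
move=> sM nM maxM F [P1 FP1] sF.
pose meets P n := exists2 m, M m & P (a ^+ n.+1 * m).
suff [P FP maxP] : exists2 P, F P & forall P', F P' -> P `<=` P' ->
    forall k x, P' x -> M (a ^- k * x) -> P x.
  exists P => // P' FP' PP' x [P'x]; case/(cyclic_extensionP sM (nM a)) => k.
  case; first exact: maxP FP' PP' _ _ P'x.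
  move=> /(maxP _ FP' PP' k _ (subgroupV (sF _ FP') P'x)).
  exact: (subgroup_preimV (sF _ FP)).
have [[n [P0 FP0 Pn] minn]|none] := pselect (exists2 n, exists2 P, F P & meets P n &
    forall P k, F P -> meets P k -> (n <= k)%N).
  have [] := maxM [set P | F P /\ P0 `<=` P].
  - by exists P0; split.
  - by move=> P [/sF].
  move=> P [FP P0P] maxP; exists P => // P' FP' PP'.
  have sP := sF _ FP; have sP' := sF _ FP'.
  case: Pn => m Mm P0m; have Pm := P0P _ P0m.
  elim/ltn_ind => -[|k] IHk x P'x Mkx.
    apply: (maxP P') => //; first by split=> // y /P0P /PP'.
    by split=> //; move: Mkx; rewrite invg1 mul1g.
  have P'k : meets P' k.
    by exists (a ^- k.+1 * x) => //; rewrite mulVKg.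
  have nk := minn _ _ FP' P'k.
  have P'x' : P' ((a ^+ n.+1 * m)^-1 * x).
    by apply: (subgroupM sP') => //; apply: (subgroupV sP'); apply: PP'.
  have : P ((a ^+ n.+1 * m)^-1 * x).
    apply: (IHk (k - n)%N) => //; first by rewrite ltnS leq_subr.
    have -> : a ^- (k - n) * ((a ^+ n.+1 * m)^-1 * x) =
        m^-1 ^ (a ^+ (k - n)) * (a ^- k.+1 * x).
      have -> : k.+1 = (n.+1 + (k - n))%N by rewrite addSn subnKC.
      by rewrite !conjgE expgnDr !gnorm.
    apply: (subgroupM sM) => //.
    exact: (nM _ _ (subgroupV sM Mm)).1.
  by move=> /(subgroupM sP Pm); rewrite mulVKg.
have [] := maxM F; first by exists P1.
  exact: sF.
move=> P FP maxP; exists P => // P' FP' PP' [|k] x P'x Mkx.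
  by apply: (maxP P') => //; split=> //; move: Mkx; rewrite invg1 mul1g.
pose p j := `[< exists2 P, F P & meets P j >].
have exp : exists j, p j.
  exists k; apply/asboolP; exists P' => //.
  by exists (a ^- k.+1 * x) => //; rewrite mulVKg.
case: none; exists (ex_minn exp); case: ex_minnP => n /asboolP pn minn //.
by move=> R j FR Rj; apply: minn; apply/asboolP; exists R.
Qed.

(** The generators of a layer are adjoined one at a time. Every intermediate
    subgroup is normal, the layer being central modulo the next term. *)
Lemma maximal_condition_layer n (A : seq G) :
  generates_layer setT n [set` A] ->
  maximal_condition (lcs setT n.+1) -> maximal_condition (lcs setT n).
Proof.
move=> [An genA] maxS; pose N := lcs setT.
have sT := subgroup_setT.
suff [M [sM NM MN AM maxM]] : exists M, [/\ is_subgroup M, N n.+1 `<=` M,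
    M `<=` N n, [set` A] `<=` M & maximal_condition M].
  by have -> : lcs setT n = M by apply/seteqP; split => //; apply: genA.
elim: A An {genA} => [|a A IHA] An.
  exists (N n.+1); split=> //; first exact: lcs_subgroup.
  exact: lcsS.
have [|M [sM NM MN AM maxM]] := IHA; first by move=> x Ax; apply: An; rewrite /= inE orbC Ax.
have nM g : normalizes g M by apply: (@lcs_normalizes setT sT n).
have Na : N n a by apply: An; rewrite /= inE eqxx.
have sMa := cyclic_extension_subgroup sM (nM a).
have MMa := @cyclic_extension_sub a M.
exists (cyclic_extension a M); split=> //.
- by move=> x /NM /MMa.
- by apply: cyclic_extension_min => //; apply: lcs_subgroup.
- move=> x /=; rewrite inE => /orP[/eqP->|Ax]; last exact/MMa/AM.
  exact: cyclic_extension_mem.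
- exact: maximal_condition_cyclic.
Qed.

Lemma maximal_condition_fg_nilpotent : finitely_generated G -> nilpotent_group G ->
  maximal_condition setT.
Proof.
move=> [S [fS genS]] [N nilN].
have genL n : exists A : seq G, generates_layer setT n [set` A].
  elim: n => [|n [A genA]].
    by have [s Es] := (finite_seqP S).1 fS; exists s; rewrite -genS -Es; exact: generates_layer0.
  have := generates_layerS subgroup_setT genS genA.
  have /finite_seqP[B ->] : finite_set [set commg a s | a in [set` A] & s in S].
    by apply: finite_image2 => //; apply/finite_seqP; exists A.
  by exists B.
have maxL n : maximal_condition (lcs setT (N - n)).
  elim: n => [|n IHn].
    rewrite subn0 -lower_central_lcs nilN => F [P FP] sF; exists P => //.
    by move=> P' FP' _ x [_ ->]; apply: subgroup1; apply: sF.
  have [Nn|nN] := leqP N n.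
    by move: IHn; rewrite (eqP Nn) subnS (eqP Nn).
  have [A genA] := genL (N - n.+1)%N; apply: maximal_condition_layer genA _.
  by rewrite subnSK.
by have := maxL N; rewrite subnn.
Qed.

(** Take the lower central series of the subgroup generated by [P] and [x].
    Commutation is biadditive from one layer to the next, so every layer is generated
    modulo the next one by elements having a power in [P]. From the last layer
    upwards, all layers lie in [P]: once a term lies in [P], the preceding one
    normalizes [P], and its generators have a power in [P]. *)
Lemma isolated_of_normalizer P : nilpotent_group G -> is_subgroup P ->
  (forall g n, normalizes g P -> P (g ^+ n.+1) -> P g) ->
  forall x n, P (x ^+ n.+1) -> P x.
Proof.
move=> [N nilN] sP torP x n Pxn.
pose S := P `|` [set x]; pose Q := subgroup_gen S.
have sQ : is_subgroup Q by apply: subgroup_gen_subgroup.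
have SQ : S `<=` Q by apply: sub_gen_smallest.
have PQ : P `<=` Q by move=> p Pp; apply: SQ; left.
have root s : S s -> exists m, P (s ^+ m.+1).
  by case=> [Ps|->]; [exists 0%N|exists n].
(* [D i]: the elements of the [i]-th term with a power in [P] modulo the next term. *)
pose D i : set G := [set a | lcs Q i a /\
  exists m p c, [/\ P p, lcs Q i.+1 c & a ^+ m.+1 = p * c]].
have sL := lcs_subgroup sQ.
have DS i a s : D i a -> S s -> D i.+1 [~ a, s].
  case=> La [m [p [c [Pp Lc Ea]]]] Ss; have Qs := SQ _ Ss.
  have [l Psl] := root s Ss; have Le := lcs_commg La Qs.
  have Qe := lcs_sub sQ Le; have Qsl := PQ _ Psl.
  split=> //; exists (m.+1 * l.+1).-1, [~ p, s ^+ l.+1].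
  exists ([~ p, s ^+ l.+1]^-1 * [~ a, s] ^+ (m.+1 * l.+1)); split.
  - by rewrite commgEl; apply: (subgroupM sP (subgroupV sP Pp)); apply: subgroupJ.
  - have Lp : lcs Q i p.
      rewrite -(mulgK c p) -Ea; apply: (subgroupM (sL i)).
        exact: (subgroupX _ (sL i)).
      exact: (subgroupV (sL i) (lcsS sQ Lc)).
    rewrite -/(lcs_cong Q i.+2 _ _) expgnA.
    apply: (lcs_cong_trans sQ (y := [~ a ^+ m.+1, s ^+ l.+1])).
      apply: lcs_cong_sym => //.
      apply: (lcs_cong_trans sQ); first exact: (lcs_cong_commXr sQ _ (subgroupX _ (sL i) La) Qs).
      apply: (lcs_congX sQ _ (subgroupX _ sQ Qe)); exact: lcs_cong_commXl.
    rewrite Ea; apply: (lcs_cong_trans sQ (lcs_cong_commMl sQ Lp (lcsS sQ Lc) Qsl)).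
    by rewrite /lcs_cong mulKg; apply: lcs_commg.
  - by rewrite prednK ?muln_gt0// mulVKg.
have genD i : exists2 A, generates_layer Q i A & A `<=` D i.
  elim: i => [|i [A genA AD]].
    exists S; first exact: generates_layer0.
    move=> s Ss; split; first exact: SQ.
    have [m Pm] := root s Ss; exists m, (s ^+ m.+1), 1; rewrite mulg1.
    by split=> //; apply: (subgroup1 (sL 1%N)).
  exists [set commg a s | a in A & s in S]; first exact: generates_layerS.
  by move=> _ [a Aa [s Ss <-]]; apply: DS => //; apply: AD.
suff LP i : lcs Q (N - i) `<=` P.
  by have := LP N; rewrite subnn; apply; apply: SQ; right.
elim: i => [|i IHi].
  move=> z /lcs_lower_central; rewrite subn0 nilN => ->; exact: subgroup1.
have [Ni|iN] := leqP N i; first by move: IHi; rewrite (eqP Ni) subnS (eqP Ni).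
have [A [_ genA] AD] := genD (N - i.+1)%N.
apply: genA => //; first by rewrite subnSK.
move=> a /AD [La [m [p [c [Pp Lc Ea]]]]].
apply: (torP a m); last first.
  by rewrite Ea; apply: (subgroupM sP) => //; apply: IHi; rewrite -subnSK.
move=> q Pq; have aJ b : lcs Q (N - i.+1) b -> P (q ^ b).
  move=> Lb; have -> : q ^ b = q * [~ b, q]^-1 by rewrite invgR commgEl mulVKg.
  apply: (subgroupM sP) => //; apply: (subgroupV sP).
  by apply: IHi; rewrite -subnSK//; apply: lcs_commg => //; apply: PQ.
by split; apply: aJ => //; apply: (subgroupV (sL _)).
Qed.

End SubgroupFacts.

(** * Finite-dimensional subspaces *)

Section LinearAlgebra.
Variables (K : fieldType) (V : lmodType K).
Implicit Types (W M : set V) (s t : seq V).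

Lemma is_subspaceP W : is_subspace W <->
  W 0 /\ forall a x y, W x -> W y -> W (a *: x + y).
Proof.
split=> -[W0 WD]; split; first by rewrite inE in W0.
- by move=> a x y Wx Wy; have := WD a x y; rewrite !inE; apply.
- by rewrite inE.
- by move=> a x y; rewrite !inE; apply: WD.
Qed.

Section Subspace.
Variable W : set V.
Hypothesis sW : is_subspace W.

Lemma subspace0 : W 0.
Proof. by case/is_subspaceP: sW. Qed.

Lemma subspaceZD a x y : W x -> W y -> W (a *: x + y).
Proof. by case/is_subspaceP: sW => _; apply. Qed.

Lemma subspaceD x y : W x -> W y -> W (x + y).
Proof. by move=> /(subspaceZD 1) /[apply]; rewrite scale1r. Qed.

Lemma subspaceZ a x : W x -> W (a *: x).
Proof. by move=> /(subspaceZD a) /(_ subspace0); rewrite addr0. Qed.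

Lemma subspaceN x : W x -> W (- x).
Proof. by move=> /(subspaceZ (-1)); rewrite scaleN1r. Qed.

Lemma subspaceB x y : W x -> W y -> W (x - y).
Proof. by move=> Wx /subspaceN; apply: subspaceD. Qed.

Lemma subspaceBr x y : W (x - y) -> W y -> W x.
Proof. by move=> Wxy /(subspaceD Wxy); rewrite subrK. Qed.

Lemma subspace_sum (I : eqType) (r : seq I) (F : I -> V) :
  {in r, forall i, W (F i)} -> W (\sum_(i <- r) F i).
Proof.
move=> WF; rewrite big_seq; elim/big_ind: _ => //; first exact: subspace0.
exact: subspaceD.
Qed.

End Subspace.

Lemma subspace_setT : is_subspace [set: V].
Proof. by apply/is_subspaceP. Qed.

Lemma subspace_set0 : is_subspace [set 0 : V].
Proof. by apply/is_subspaceP; split=> // a _ _ -> ->; rewrite /= scaler0 addr0. Qed.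

Lemma subspaceI W M : is_subspace W -> is_subspace M -> is_subspace (W `&` M).
Proof.
move=> sW sM; apply/is_subspaceP; split; first by split; exact: subspace0.
by move=> a x y [Wx Mx] [Wy My]; split; apply: subspaceZD.
Qed.

Lemma subspace_preimage (f : {linear V -> V}) W :
  is_subspace W -> is_subspace [set v | W (f v)].
Proof.
move=> sW; apply/is_subspaceP; split; first by rewrite /= linear0; apply: subspace0.
by move=> a x y Wx Wy; rewrite /= linearP; apply: subspaceZD.
Qed.

Definition subspace_add W M : set V := [set v | exists2 w, W w & M (v - w)].

Lemma subspace_add_subspace W M :
  is_subspace W -> is_subspace M -> is_subspace (subspace_add W M).
Proof.
move=> sW sM; apply/is_subspaceP; split.
  by exists 0; rewrite ?subrr; exact: subspace0.
move=> a x y [w Ww Mx] [w' Ww' My]; exists (a *: w + w'); first exact: subspaceZD.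
rewrite opprD addrACA -scalerBr; exact: subspaceZD.
Qed.

Lemma subspace_addl W M : is_subspace M -> W `<=` subspace_add W M.
Proof. by move=> sM w Ww; exists w; rewrite // subrr; apply: subspace0. Qed.

Lemma subspace_addr W M : is_subspace W -> M `<=` subspace_add W M.
Proof. by move=> sW m Mm; exists 0; rewrite ?subr0 //; apply: subspace0. Qed.

Lemma subspace_add_min W M L : is_subspace L -> W `<=` L -> M `<=` L ->
  subspace_add W M `<=` L.
Proof.
by move=> sL WL ML v [w /WL Lw /ML]; move=> /(subspaceBr sL); apply.
Qed.

Fixpoint seq_span s : set V :=
  if s is x :: s' then [set v | exists c, seq_span s' (v - c *: x)] else [set 0].

Lemma seq_span_subspace s : is_subspace (seq_span s).
Proof.
elim: s => [|x s IHs] /=; first exact: subspace_set0.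
apply/is_subspaceP; split; first by exists 0; rewrite scale0r subr0; apply: subspace0.
move=> a u v [c Hu] [d Hv]; exists (a * c + d).
by rewrite scalerDl opprD addrACA -scalerA -scalerBr; apply: subspaceZD.
Qed.

Lemma seq_span_behead x s : seq_span s `<=` seq_span (x :: s).
Proof. by move=> v sv; exists 0; rewrite scale0r subr0. Qed.

Lemma seq_span_mem s x : x \in s -> seq_span s x.
Proof.
elim: s => // y s IHs; rewrite inE => /orP[/eqP->|/IHs].
  by exists 1; rewrite scale1r subrr; exact: (subspace0 (seq_span_subspace s)).
exact: seq_span_behead.
Qed.

Lemma seq_span_min s W : is_subspace W -> {in s, forall x, W x} -> seq_span s `<=` W.
Proof.
move=> sW; elim: s => [|x s IHs] Ws v /=; first by move=> ->; apply: subspace0.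
move=> [c /IHs]; rewrite -{2}(subrK (c *: x) v) => Wv; apply: subspaceD => //.
  by apply: Wv => y ys; apply: Ws; rewrite inE ys orbT.
by apply: subspaceZ => //; apply: Ws; rewrite mem_head.
Qed.

Lemma seq_spanP s v : seq_span s v ->
  exists a : 'rV[K]_(size s), v = \sum_(i < size s) a 0 i *: s`_i.
Proof.
elim: s v => [|x s IHs] v /=; first by move=> ->; exists 0; rewrite big_ord0.
move=> [c /IHs[a Ea]].
exists (\row_j if unlift ord0 j is Some i then a 0 i else c).
rewrite big_ord_recl -[LHS](subrK (c *: x)) Ea addrC mxE unlift_none; congr (_ + _).
by apply: eq_bigr => i _; rewrite mxE liftK.
Qed.

(** Elimination: a vector of [W] outside the span of the tail of [s] can replace the
    head of [s]. *)
Lemma seq_span_sub s W : is_subspace W -> W `<=` seq_span s ->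
  seq_span s `<=` W \/ exists2 t, (size t < size s)%N & W = seq_span t.
Proof.
elim: s W => [|x s IHs] W sW Ws; first by left=> v /= ->; apply: subspace0.
have sS := seq_span_subspace s.
have [WS|/existsNP[w0 /not_implyP[Ww0 Sw0]]] := pselect (W `<=` seq_span s).
  right; have [SW|[t st ->]] := IHs _ sW WS; last by exists t => //=; exact: ltnW.
  by exists s => //; apply/seteqP.
have [c Sc] := Ws _ Ww0.
have c0 : c != 0.
  by apply: contra_notN Sw0 => /eqP c0; move: Sc; rewrite c0 scale0r subr0.
have Wspan t : W `&` seq_span s = seq_span t -> W = seq_span (w0 :: t).
  move=> Et; apply/seteqP; split=> [w Ww|].
    have [d Sd] := Ws _ Ww; exists (d / c); rewrite -Et.
    split; first by apply: subspaceB => //; apply: subspaceZ.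
    have -> : w - (d / c) *: w0 = (w - d *: x) - (d / c) *: (w0 - c *: x).
      by rewrite scalerBr scalerA divfK// opprB addrA subrK.
    by apply: subspaceB => //; apply: subspaceZ.
  apply: seq_span_min => // y; rewrite inE => /orP[/eqP->//|/seq_span_mem].
  by rewrite -Et => -[].
have [SW|[t st /Wspan ->]] := IHs _ (subspaceI sW sS) (@subIsetr _ _ _); last first.
  by right; exists (w0 :: t).
left; apply: seq_span_min => // y; rewrite inE => /orP[/eqP->|/seq_span_mem/SW[]//].
have -> : x = c^-1 *: (w0 - (w0 - c *: x)).
  by rewrite opprB addrC subrK scalerA mulVf// scale1r.
by apply: subspaceZ => //; apply: subspaceB => //; apply: (SW _ Sc).1.
Qed.

(** Only an upper bound is asked for, which makes the notion inherited by subsets;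
    [fin_dim_span] recovers an exact spanning sequence. *)
Definition fin_dim W := exists s, W `<=` seq_span s.

Lemma fin_dim_span W : is_subspace W -> fin_dim W -> exists s, W = seq_span s.
Proof.
move=> sW [s Ws]; have [sWs|[t _ ->]] := seq_span_sub sW Ws; last by exists t.
by exists s; apply/seteqP.
Qed.

(** Induction on the dimension: a proper subspace is spanned by fewer vectors. *)
Lemma fin_dim_ind (Q : set V -> Prop) :
  (forall W, is_subspace W -> fin_dim W ->
     (forall M, is_subspace M -> M `<=` W -> ~ W `<=` M -> Q M) -> Q W) ->
  forall W, is_subspace W -> fin_dim W -> Q W.
Proof.
move=> IH W sW fW; have [s Es] := fin_dim_span sW fW.
elim: {s}_.+1 {-2}s (ltnSn (size s)) W sW fW Es => // n IHn s sn W sW fW Es.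
apply: IH => // M sM; rewrite {1}Es => MW; rewrite {1}Es => WM.
have [//|[t ts Et]] := seq_span_sub sM MW.
apply: (IHn t) => //; first exact: leq_trans ts _.
by exists t; rewrite Et.
Qed.

Lemma fin_dimS W M : W `<=` M -> fin_dim M -> fin_dim W.
Proof. by move=> WM [s Ms]; exists s => x /WM/Ms. Qed.

Lemma finite_dimensionalP W : finite_dimensional W -> fin_dim W.
Proof.
move=> [B [/finite_seqP[s ->] [_ <-]]]; exists s; apply: smallest_sub.
  exact: seq_span_subspace.
by move=> v; apply: seq_span_mem.
Qed.

Lemma seq_span_dependent s n (f : nat -> V) : (size s < n)%N ->
  (forall i, (i < n)%N -> seq_span s (f i)) ->
  exists2 c : nat -> K, exists2 i, (i < n)%N & c i != 0 &
    \sum_(i < n) c i *: f i = 0.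
Proof.
move=> sn sf.
have /choice[a Ea] : forall i : 'I_n, exists a : 'rV[K]_(size s),
    f i = \sum_(j < size s) a 0 j *: s`_j by move=> i; apply/seq_spanP/sf.
pose A := \matrix_(i < n, j < size s) a i 0 j.
have /rowV0Pn[u /sub_kermxP uA u0] : kermx A != 0.
  rewrite -mxrank_eq0 mxrank_ker subn_eq0 -ltnNge.
  exact: leq_ltn_trans (rank_leq_col A) sn.
have /existsP[i ui] : [exists i, u 0 i != 0].
  apply: contraNT u0; rewrite negb_exists => /forallP u0; apply/eqP/rowP => i.
  by rewrite mxE; apply/eqP; have := u0 i; rewrite negbK.
exists (fun k => if insub k is Some k' then u 0 k' else 0).
  by exists i => //; rewrite valK.
rewrite (eq_bigr (fun k => \sum_(j < size s) (u 0 k * A k j) *: s`_j)); last first.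
  move=> k _; rewrite valK Ea scaler_sumr; apply: eq_bigr => j _.
  by rewrite scalerA mxE.
rewrite exchange_big big1// => j _; rewrite -scaler_suml.
have -> : \sum_(k < n) u 0 k * A k j = (u *m A) 0 j by rewrite mxE.
by rewrite uA mxE scale0r.
Qed.

(** Since [f] maps [W] into itself, [W] is contained in its image under [g], which
    is spanned by as many vectors; were it a proper subspace, [W] would be spanned by
    fewer vectors than any of its spanning sequences has. *)
Lemma fin_dim_surj W (f g : {linear V -> V}) : cancel f g -> cancel g f ->
  is_subspace W -> fin_dim W -> (forall w, W w -> W (f w)) ->
  forall w, W w -> W (g w).
Proof.
move=> fK gK sW fW Wf; have [s] := fin_dim_span sW fW.
elim: {s}_.+1 {-2}s (ltnSn (size s)) => // n IHn s sn Es.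
have WM : W `<=` seq_span (map g s).
  move=> w /Wf; rewrite Es -{2}(fK w); elim: (s) (f w) => [|x t IHt] v /=.
    by move=> ->; rewrite linear0.
  by move=> [c /IHt]; rewrite linearB linearZ; exists c.
have [MW w Ww|[t ts Et]] := seq_span_sub sW WM; last first.
  by apply: (IHn t) => //; rewrite size_map in ts; exact: leq_trans ts _.
apply: MW; move: Ww; rewrite Es; elim: (s) (w) => [|x t IHt] v /=.
  by move=> ->; rewrite linear0.
by move=> [c /IHt]; rewrite linearB linearZ; exists c.
Qed.

End LinearAlgebra.

(** * Modules and homomorphisms inside a representation *)

Section Modules.
Variables (K : fieldType) (G : groupType) (V : lmodType K).
Variable pi : representation G V.
Implicit Types (P H A : set G) (W M Y Z U : set V) (g p : G) (th : V -> V).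

Lemma repr_funK g : cancel (pi g) (pi g^-1%g).
Proof. by move=> v; rewrite -repr_funM mulVg repr_fun1. Qed.

Lemma repr_funVK g : cancel (pi g^-1%g) (pi g).
Proof. by move=> v; rewrite -repr_funM mulgV repr_fun1. Qed.

Lemma repr_eq0 g v : pi g v = 0 -> v = 0.
Proof. by move=> gv0; rewrite -(repr_funK g v) gv0 linear0. Qed.

Lemma repr_funJ g p v : pi p (pi g v) = pi g (pi (p ^ g)%g v).
Proof. by rewrite -!repr_funM conjgE !mulgA mulgV mul1g. Qed.

Lemma repr_funVJ g p v : pi g^-1%g (pi p v) = pi (p ^ g)%g (pi g^-1%g v).
Proof. by rewrite -!repr_funM conjgE !mulgA mulgK. Qed.

Definition stable P W := forall p w, P p -> W w -> W (pi p w).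

Definition submodule P W := is_subspace W /\ stable P W.

(** Zero is allowed, so that images of simple modules need no case distinction. *)
Definition simple_or_zero P W := submodule P W /\
  forall M, submodule P M -> M `<=` W -> M `<=` [set 0] \/ W `<=` M.

Definition nonzero W := exists2 w, W w & w != 0.

Lemma nonzeroPn W : ~ nonzero W -> W `<=` [set 0].
Proof.
by move=> W0 w Ww; apply/eqP; case: eqP => // /eqP w0; case: W0; exists w.
Qed.

Lemma not_sub0 W : ~ W `<=` [set 0] -> nonzero W.
Proof. by move=> W0; apply: contra_notP W0 => /nonzeroPn. Qed.

Lemma nonzero_not_sub0 W : nonzero W -> ~ W `<=` [set 0].
Proof. by move=> [w Ww /eqP w0] /(_ _ Ww). Qed.

Lemma submodule0 P : submodule P [set 0].
Proof.
by split; [exact: subspace_set0|move=> p _ _ ->; rewrite /= linear0].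
Qed.

Lemma submoduleI P W M : submodule P W -> submodule P M -> submodule P (W `&` M).
Proof.
move=> [sW tW] [sM tM]; split; first exact: subspaceI.
by move=> p v Pp [Wv Mv]; split; [exact: tW|exact: tM].
Qed.

Lemma submodule_add P W M :
  submodule P W -> submodule P M -> submodule P (subspace_add W M).
Proof.
move=> [sW tW] [sM tM]; split; first exact: subspace_add_subspace.
move=> p v Pp [w Ww Mvw]; exists (pi p w); first exact: tW.
by rewrite -linearB; apply: tM.
Qed.

Lemma submoduleS P H W : H `<=` P -> submodule P W -> submodule H W.
Proof. by move=> HP [sW tW]; split=> // p w /HP; apply: tW. Qed.

(** A homomorphism of [P]-modules from [W] to [V]. It is carried by a function on all
    of [V], whose values outside [W] are irrelevant. *)
Definition equivariant P W th :=
  (forall a x y, W x -> W y -> th (a *: x + y) = a *: th x + th y) /\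
  (forall p w, P p -> W w -> th (pi p w) = pi p (th w)).

Section Hom.
Variables (P : set G) (W : set V) (th : V -> V).
Hypotheses (smW : submodule P W) (hth : equivariant P W th).

Lemma hom0 : th 0 = 0.
Proof.
have W0 := subspace0 smW.1; have := hth.1 (-1) 0 0 W0 W0.
by rewrite scaler0 addr0 scaleN1r addNr.
Qed.

Lemma homZD a x y : W x -> W y -> th (a *: x + y) = a *: th x + th y.
Proof. exact: hth.1. Qed.

Lemma hom_image : submodule P [set th w | w in W].
Proof.
have [sW tW] := smW; split.
  apply/is_subspaceP; split; first by exists 0; [exact: subspace0|exact: hom0].
  move=> a _ _ [x Wx <-] [y Wy <-]; exists (a *: x + y); last exact: homZD.
  exact: subspaceZD.
move=> p _ Pp [x Wx <-]; exists (pi p x); first exact: tW.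
exact: hth.2.
Qed.

Lemma hom_preimage M : submodule P M -> submodule P (W `&` [set w | M (th w)]).
Proof.
have [sW tW] := smW; move=> [sM tM]; split.
  apply/is_subspaceP; split.
    by split; [exact: subspace0|rewrite /= hom0; apply: subspace0].
  move=> a x y [Wx Mx] [Wy My]; split; first exact: subspaceZD.
  by rewrite /= homZD//; apply: subspaceZD.
move=> p x Pp [Wx Mx]; split; first exact: tW.
by rewrite /= hth.2//; apply: tM.
Qed.

End Hom.

Lemma hom_comp P W M th et : equivariant P W th -> equivariant P M et ->
  (forall w, W w -> M (th w)) -> equivariant P W (et \o th).
Proof.
move=> [lth eth] [let_ eet] thM; split=> [a x y Wx Wy|p w Pp Ww] /=.
  by rewrite lth// let_//; apply: thM.
by rewrite eth// eet//; apply: thM.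
Qed.

Lemma homS P W M th : M `<=` W -> equivariant P W th -> equivariant P M th.
Proof.
by move=> MW [lth eth]; split=> [a x y /MW Wx /MW Wy|p w Pp /MW Ww];
  [exact: lth|exact: eth].
Qed.

Lemma hom_sub P H W th : H `<=` P -> equivariant P W th -> equivariant H W th.
Proof. by move=> HP [lth eth]; split=> // p w /HP; apply: eth. Qed.

(** Several homomorphisms below are obtained from their graphs; in particular this
    yields the projections onto the summands of a direct sum. *)
Lemma hom_of_rel P W (T : V -> V -> Prop) : submodule P W ->
  (forall a x y x' y', W x -> W y -> T x x' -> T y y' -> T (a *: x + y) (a *: x' + y')) ->
  (forall p x x', P p -> W x -> T x x' -> T (pi p x) (pi p x')) ->
  (forall x, W x -> exists x', T x x') ->
  (forall x', T 0 x' -> x' = 0) ->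
  exists2 th, equivariant P W th & forall x, W x -> T x (th x).
Proof.
move=> [sW tW] TZD Tp Tex T0.
have /choice[th Tth] : forall x, exists x', W x -> T x x'.
  move=> x; have [/Tex[x' Tx]|nWx] := pselect (W x); first by exists x'.
  by exists 0.
have Tinj x x' x'' : W x -> T x x' -> T x x'' -> x' = x''.
  move=> Wx Tx' Tx''; apply/eqP; rewrite -subr_eq0; apply/eqP/T0.
  have := TZD (-1) x x x'' x' Wx Wx Tx'' Tx'.
  by rewrite !scaleN1r addNr addrC.
exists th => //; split=> [a x y Wx Wy|p w Pp Ww].
  have Wxy : W (a *: x + y) by apply: subspaceZD.
  by apply: Tinj (Tth _ Wxy) _ => //; apply: TZD => //; apply: Tth.
by apply: Tinj (Tth _ (tW _ _ Pp Ww)) _; [exact: tW|apply: Tp => //; apply: Tth].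
Qed.

Definition nonzero_on W th := exists2 w, W w & th w != 0.

Lemma hom_inj P W th : simple_or_zero P W -> equivariant P W th -> nonzero_on W th ->
  forall w, W w -> th w = 0 -> w = 0.
Proof.
move=> [smW simW] hth [w0 Ww0 thw0] w Ww thw.
have [|Z0|WZ] := simW _ (hom_preimage smW hth (submodule0 P)).
- by move=> ? [].
- by apply: Z0; split.
- by have [_ /= thw00] := WZ _ Ww0; rewrite thw00 eqxx in thw0.
Qed.

Lemma hom_image_simple P W th : simple_or_zero P W -> equivariant P W th ->
  simple_or_zero P [set th w | w in W].
Proof.
move=> [smW simW] hth; split; first exact: hom_image.
move=> M smM MW.
have [|Z0|WZ] := simW _ (hom_preimage smW hth smM).
- by move=> ? [].
- left=> m Mm; have [w Ww Em] := MW _ Mm.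
  have w0 : w = 0 by apply: Z0; split; rewrite //= Em.
  by rewrite -Em w0; apply: (hom0 smW hth).
- by right=> _ [w Ww <-]; apply: (WZ _ Ww).2.
Qed.

Lemma hom_onto P W Y th : submodule P W -> simple_or_zero P Y -> equivariant P W th ->
  nonzero_on W th -> (forall w, W w -> Y (th w)) -> [set th w | w in W] = Y.
Proof.
move=> smW [_ simY] hth [w Ww thw] thY; apply/seteqP.
have imY : [set th w | w in W] `<=` Y by move=> _ [u Wu <-]; apply: thY.
split=> //; have [im0|//] := simY _ (hom_image smW hth) imY.
by case/eqP: thw; apply: im0; exists w.
Qed.

Definition translate g W : set V := [set v | W (pi g^-1%g v)].

Lemma translate_mem g W w : W w -> translate g W (pi g w).
Proof. by rewrite /translate /= repr_funK. Qed.

Lemma translate_subspace g W : is_subspace W -> is_subspace (translate g W).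
Proof. exact: subspace_preimage. Qed.

Lemma translate_submodule P g W : normalizes g P ->
  submodule P W -> submodule P (translate g W).
Proof.
move=> nP [sW tW]; split; first exact: translate_subspace.
move=> p w Pp Ww; rewrite /translate /= repr_funVJ; apply: tW => //.
exact: (nP _ Pp).1.
Qed.

Lemma translate_simple P g W : normalizes g P ->
  simple_or_zero P W -> simple_or_zero P (translate g W).
Proof.
move=> nP [smW simW]; split; first exact: translate_submodule.
move=> M smM MW; have smM' := translate_submodule (normalizesV nP) smM.
have [|Z0|WM] := simW _ smM'.
- by move=> v Mv; have := MW _ Mv; rewrite /translate /= invgK repr_funK.
- left=> m Mm; rewrite -(repr_funVK g m) (Z0 (pi g^-1%g m)) ?linear0//.
  by rewrite /translate /= invgK repr_funVK.
- right=> v /WM; by rewrite /translate /= invgK repr_funVK.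
Qed.

Lemma translate_stable L g W : submodule L W -> L g -> is_subgroup L -> translate g W = W.
Proof.
move=> [sW tW] Lg sL; apply/seteqP; split=> v Wv.
  by rewrite -(repr_funVK g v); apply: tW.
by apply: tW => //; apply: subgroupV.
Qed.

Lemma hom_conj P g W th : normalizes g P -> submodule P W -> equivariant P W th ->
  equivariant P (translate g W) (fun v => pi g (th (pi g^-1%g v))).
Proof.
move=> nP [_ tW] [lth eth]; split=> [a x y Wx Wy|p w Pp Ww].
  by rewrite linearP lth// linearP.
have Ppg := (nP _ Pp).1.
by rewrite repr_funVJ eth// -repr_funJ.
Qed.

(** * Finite sums of simple modules *)

Definition sum_modules Z (Ys : seq (set V)) := foldr (@subspace_add K V) Z Ys.

Lemma sum_modules_submodule P Z Ys : submodule P Z ->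
  {in Ys, forall Y, submodule P Y} -> submodule P (sum_modules Z Ys).
Proof.
move=> smZ; elim: Ys => // Y Ys IHYs smY; apply: submodule_add.
  by apply: smY; rewrite mem_head.
by apply: IHYs => Y' Y's; apply: smY; rewrite inE Y's orbT.
Qed.

Lemma sum_modules_base Z Ys : {in Ys, forall Y, is_subspace Y} ->
  Z `<=` sum_modules Z Ys.
Proof.
elim: Ys => [|Y Ys IHYs] sY z Zz //; apply: subspace_addr.
  by apply: sY; rewrite mem_head.
by apply: IHYs => // Y' Y's; apply: sY; rewrite inE Y's orbT.
Qed.

(** A nonzero submodule of a sum of simple modules contains a copy of one of them.
    By induction [M] may be assumed to meet the sum [S] of all summands but [Y] in
    zero; then [M] embeds into [Y] modulo [S], and the inverse of this embedding is
    the required homomorphism. *)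
Lemma simple_sub_of_sum P Ys M : {in Ys, forall Y, simple_or_zero P Y} ->
  submodule P M -> nonzero M -> M `<=` sum_modules [set 0] Ys ->
  exists2 Y, Y \in Ys & exists th,
    [/\ equivariant P Y th, nonzero_on Y th & forall y, Y y -> M (th y)].
Proof.
elim: Ys M => [|Y Ys IHYs] M simYs smM nzM MYs.
  by case: (nonzero_not_sub0 nzM).
have simY := simYs _ (mem_head _ _).
have simYs' : {in Ys, forall Y, simple_or_zero P Y}.
  by move=> Y' Y's; apply: simYs; rewrite inE Y's orbT.
set S := sum_modules [set 0] Ys; have smS : submodule P S.
  by apply: sum_modules_submodule => [|Y' /simYs' []//]; exact: submodule0.
have [nzMS|MS0] := pselect (nonzero (M `&` S)).
  have [||Y' Y's [th [hth nzth thM]]] := IHYs _ simYs' _ nzMS.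
  - exact: submoduleI.
  - exact: subIsetr.
  exists Y'; first by rewrite inE Y's orbT.
  by exists th; split=> // y /thM[].
have {}MS0 := nonzeroPn MS0.
pose Y1 := [set y | Y y /\ exists2 m, M m & S (m - y)].
have [sS tS] := smS; have [sM tM] := smM.
have smY1 : submodule P Y1.
  have [[sY tY] _] := simY; split.
    apply/is_subspaceP; split.
      split; first exact: subspace0.
      by exists 0; rewrite ?subrr; exact: subspace0.
    move=> a x y [Yx [m Mm Sm]] [Yy [m' Mm' Sm']]; split; first exact: subspaceZD.
    exists (a *: m + m'); first exact: subspaceZD.
    by rewrite opprD addrACA -scalerBr; exact: subspaceZD.
  move=> p y Pp [Yy [m Mm Sm]]; split; first exact: tY.
  by exists (pi p m); [exact: tM|rewrite -linearB; exact: tS].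
have [|Y10|YY1] := simY.2 _ smY1; first by move=> ? [].
  have [m Mm m0] := nzM; have [y Yy Smy] := MYs _ Mm.
  have y0 : y = 0 by apply: Y10; split=> //; exists m.
  by case/eqP: m0; apply: MS0; split=> //; rewrite -(subr0 m) -y0.
have [|||x' [Mx' Sx']|th hth Tth] :=
    @hom_of_rel P Y (fun y m => M m /\ S (m - y)) simY.1.
- move=> a x y x' y' _ _ [Mx Sx] [My Sy]; split; first exact: subspaceZD.
  by rewrite opprD addrACA -scalerBr; exact: subspaceZD.
- move=> p x x' Pp _ [Mx Sx]; split; first exact: tM.
  by rewrite -linearB; exact: tS.
- by move=> y /YY1[_ [m Mm Smy]]; exists m.
- by apply: MS0; split=> //; rewrite -(subr0 x').
exists Y; first exact: mem_head.
exists th; split=> //; last by move=> y /Tth[].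
apply: contrapT => th0; have [m Mm /eqP[]] := nzM; apply: MS0; split=> //.
have [y Yy Smy] := MYs _ Mm; apply: (subspaceBr sS Smy).
have [_] := Tth _ Yy; rewrite (_ : th y = 0) ?sub0r => [/(subspaceN sS)|].
  by rewrite opprK.
by apply/eqP; case: eqP => // /eqP thy; case: th0; exists y.
Qed.

(** The summands [Y] are removed one at a time. If [Y] is not already contained in
    the sum of the others, the two meet in zero; then the component of [th] in [Y] is
    a homomorphism to [Y], and therefore vanishes. *)
Lemma hom_to_sum P W Z Ys th : submodule P W -> submodule P Z ->
  {in Ys, forall Y, simple_or_zero P Y} ->
  {in Ys, forall Y, ~ exists et,
    [/\ equivariant P W et, nonzero_on W et & forall w, W w -> Y (et w)]} ->
  equivariant P W th -> (forall w, W w -> sum_modules Z Ys (th w)) ->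
  forall w, W w -> Z (th w).
Proof.
move=> smW smZ; elim: Ys => [//|Y Ys IHYs] simYs noY hth thYs.
have simY := simYs _ (mem_head _ _).
have simYs' : {in Ys, forall Y, simple_or_zero P Y}.
  by move=> Y' Y's; apply: simYs; rewrite inE Y's orbT.
apply: IHYs => //; first by move=> Y' Y's; apply: noY; rewrite inE Y's orbT.
move=> w Ww; set S := sum_modules Z Ys.
have smS : submodule P S.
  by apply: sum_modules_submodule => // Y' /simYs' [].
have [[sS tS] [sY tY]] := (smS, simY.1).
have thw := thYs _ Ww.
have [YS0|YS] := simY.2 _ (submoduleI simY.1 smS) (@subIsetl _ _ _); last first.
  by apply: subspace_add_min thw => // y /YS[].
have [|||x' [Yx' Sx']|et het Tet] :=
    @hom_of_rel P W (fun w y => Y y /\ S (th w - y)) smW.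
- move=> a x y x' y' Wx Wy [Mx Sx] [My Sy]; split; first exact: subspaceZD.
  by rewrite (homZD hth)// opprD addrACA -scalerBr; exact: subspaceZD.
- move=> p x x' Pp Wx [Mx Sx]; split; first exact: tY.
  by rewrite hth.2// -linearB; exact: tS.
- by move=> x /thYs[y Yy Sy]; exists y.
- apply: YS0; split=> //; move: Sx'; rewrite (hom0 smW hth) sub0r => /(subspaceN sS).
  by rewrite opprK.
have [_ Sw] := Tet _ Ww; suff etw : et w = 0 by rewrite etw subr0 in Sw.
apply/eqP; case: eqP => // /eqP etw; case: (noY _ (mem_head _ _)).
by exists et; split=> // [|x /Tet[]]; first by exists w.
Qed.

(** * Sums of translates and induced modules *)

Inductive translate_sum A W : V -> Prop :=
| translate_sum0 : translate_sum A W 0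
| translate_sumD g w v : A g -> W w -> translate_sum A W v ->
    translate_sum A W (pi g w + v).

End Modules.

Section Imprimitivity.
Variables (K : fieldType) (G : groupType) (V : lmodType K).
Variable pi : representation G V.
Implicit Types (P H A B L N : set G) (W M U : set V) (g p x y : G) (th : V -> V).

Local Notation translate_sum := (translate_sum pi).

Lemma translate_sum_mem A W g w : A g -> W w -> translate_sum A W (pi g w).
Proof.
by move=> Ag Ww; rewrite -[X in translate_sum _ _ X]addr0; apply: translate_sumD => //;
  exact: translate_sum0.
Qed.

Lemma translate_sum_scalable A W : (forall c w, W w -> W (c *: w)) ->
  is_subspace (translate_sum A W).
Proof.
move=> cW; apply/is_subspaceP; split; first exact: translate_sum0.
move=> a x y + Wy; elim=> [|g w v Ag Ww _]; first by rewrite scaler0 add0r.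
by rewrite scalerDr -addrA -linearZ; apply: translate_sumD => //; apply: cW.
Qed.

Lemma translate_sum_subspace A W : is_subspace W -> is_subspace (translate_sum A W).
Proof. by move=> sW; apply: translate_sum_scalable => c w; apply: subspaceZ. Qed.

Lemma translate_sum_min A W M : is_subspace M ->
  (forall g w, A g -> W w -> M (pi g w)) -> translate_sum A W `<=` M.
Proof.
move=> sM AM v; elim=> [|g w u Ag Ww _ Mu]; first exact: subspace0.
by apply: subspaceD => //; apply: AM.
Qed.

Lemma translate_sumS A B W M : A `<=` B -> W `<=` M ->
  translate_sum A W `<=` translate_sum B M.
Proof.
move=> AB WM v; elim=> [|g w u Ag Ww _]; first exact: translate_sum0.
by apply: translate_sumD; [exact: AB|exact: WM].
Qed.

Lemma translate_sum_act A B W x : (forall g, A g -> B (x * g)%g) ->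
  forall v, translate_sum A W v -> translate_sum B W (pi x v).
Proof.
move=> AB v; elim=> [|g w u Ag Ww _]; first by rewrite linear0; exact: translate_sum0.
by rewrite linearD -repr_funM; apply: translate_sumD => //; apply: AB.
Qed.

Lemma translate_sum_submodule P W : is_subgroup P -> is_subspace W ->
  submodule pi P (translate_sum P W).
Proof.
move=> sP sW; split; first exact: translate_sum_subspace.
by move=> p v Pp; apply: translate_sum_act => g; apply: subgroupM.
Qed.

Lemma translate_sum_sub P W : is_subgroup P -> W `<=` translate_sum P W.
Proof.
move=> sP w Ww; rewrite -(repr_fun1 pi w); apply: translate_sum_mem => //.
exact: subgroup1.
Qed.

Lemma translate_sum_simple P W U : is_subgroup P -> simple_or_zero pi P W ->
  is_subspace U -> U `<=` W -> nonzero U -> translate_sum P U = W.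
Proof.
move=> sP [[sW tW] simW] sU UW [u Uu u0]; apply/seteqP.
have sub : translate_sum P U `<=` W.
  by apply: translate_sum_min => // g w Pg /UW; apply: tW.
split=> //; have [/(_ _ (translate_sum_sub sP Uu)) /eqP|//] :=
  simW _ (translate_sum_submodule sP sU) sub.
by rewrite (negPf u0).
Qed.

Lemma translate_sum_finite A W v : translate_sum A W v ->
  exists2 s : seq G, [set` s] `<=` A & translate_sum [set` s] W v.
Proof.
elim=> [|g w u Ag Ww _ [s sA su]]; first by exists [::] => //; exact: translate_sum0.
exists (g :: s).
  by move=> x /=; rewrite inE => /orP[/eqP->|/sA].
apply: translate_sumD => //=; first exact: mem_head.
by apply: translate_sumS su => // x /= xs; rewrite inE xs orbT.
Qed.

Lemma translate_sum_modules s W Z : is_subspace W -> is_subspace Z ->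
  translate_sum [set` s] W `<=` sum_modules Z [seq translate pi g W | g <- s].
Proof.
move=> sW sZ; have sub t : is_subspace (sum_modules Z [seq translate pi g W | g <- t]).
  by elim: t => //= g t IHt; apply: subspace_add_subspace => //; apply: translate_subspace.
apply: translate_sum_min => // g w; elim: s => // h s IHs.
rewrite /= inE => /orP[/eqP->|/IHs + Ww] => [Ww|/(_ Ww) sw].
  by apply: (subspace_addl (sub s)); apply: translate_mem.
exact: (subspace_addr (translate_subspace pi h sW) sw).
Qed.

(** For an [H]-module [W] this says that the translates of [W] by the cosets of [H]
    in [L] form a direct sum, that is, the [L]-module they span is induced from [W]:
    translating a relation, one may always single out the coset of [1]. *)
Definition imprimitive L H W :=
  forall w, W w -> translate_sum (L `\` H) W w -> w = 0.

Lemma translate_sum_split L H W v : is_subgroup H -> submodule pi H W ->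
  translate_sum L W v -> exists2 w, W w & translate_sum (L `\` H) W (v - w).
Proof.
move=> sH [sW tW]; elim=> [|g w u Lg Ww _ [u' Wu' IH]].
  by exists 0; [exact: subspace0|rewrite subrr; exact: translate_sum0].
have [Hg|Hg] := pselect (H g).
  by exists (pi g w + u'); [apply: subspaceD => //; apply: tW|rewrite opprD addrACA subrr add0r].
by exists u' => //; rewrite -addrA; apply: translate_sumD.
Qed.

Lemma translate_sum_setD_stable L H W : is_subgroup L -> is_subgroup H ->
  H `<=` L -> stable pi H (translate_sum (L `\` H) W).
Proof.
move=> sL sH HL h v Hh; apply: translate_sum_act => g [Lg nHg]; split.
  by apply: (subgroupM sL) => //; apply: HL.
by move=> /(subgroupM sH (subgroupV sH Hh)); rewrite mulKg.
Qed.

(** Transitivity of induction: an element of [L] outside [H] translates [U] either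
    within [translate_sum N U], away from [U], or into another translate of
    [translate_sum N U]. *)
Lemma imprimitive_trans L N H U : is_subgroup N -> H `<=` N -> N `<=` L ->
  is_subspace U ->
  imprimitive N H U -> imprimitive L N (translate_sum N U) -> imprimitive L H U.
Proof.
move=> sN HN NL sU impN impL u Uu.
have sW := translate_sum_subspace N sU; set W := translate_sum N U in sW impL.
have sR := translate_sum_subspace (N `\` H) sU.
have sS := translate_sum_subspace (L `\` N) sW.
have sub : translate_sum (L `\` H) U `<=`
    subspace_add (translate_sum (N `\` H) U) (translate_sum (L `\` N) W).
  apply: translate_sum_min; first exact: subspace_add_subspace.
  move=> g w [Lg Hg] Uw; have [Ng|Ng] := pselect (N g).
    by apply: (subspace_addl sS); apply: translate_sum_mem.
  apply: (subspace_addr sR); apply: translate_sum_mem => //.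
  exact: translate_sum_sub.
move=> /sub[r Rr Sur]; apply: impN => //; rewrite -(subrK r u).
have Wr : W r by apply: translate_sumS Rr => // ? [].
by rewrite (impL (u - r)) ?add0r//; apply: subspaceB => //; apply: translate_sum_sub.
Qed.

(** * Clifford theory along the normalizers of an isolated subgroup *)

(** The hypotheses on [P] and [U] are those which a maximal choice of the pair
    provides: [P] is isolated, it contains none of its proper conjugates, and an
    element normalizing [P] and carrying [U] to an isomorphic module lies in [P]. *)
Section CliffordStep.
Variables (P : set G) (U : set V).
Hypotheses (sP : is_subgroup P) (simU : simple_or_zero pi P U) (nzU : nonzero U).
Hypothesis fdU : fin_dim U.
Hypothesis isoP : forall x n, P (x ^+ n.+1)%g -> P x.
Hypothesis normP : forall y, (forall p, P p -> P (p ^ y)%g) -> normalizes y P.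
Hypothesis selfP : forall y th, normalizes y P -> equivariant pi P U th -> nonzero_on U th ->
  (forall u, U u -> translate pi y U (th u)) -> P y.

Let smU := simU.1.
Let sU := smU.1.

Definition irreducibly_induced N :=
  simple_or_zero pi N (translate_sum N U) /\ imprimitive N P U.

Section NoHom.
Variables (N : set G) (g : G).
Hypotheses (sN : is_subgroup N) (PN : P `<=` N) (indN : irreducibly_induced N).
Hypotheses (nN : normalizes g N) (Ng : ~ N g).
Let W := translate_sum N U.
Let R := translate_sum (N `\` P) U.

(** The image of [U] meets finitely many translates only, because [U] has finite
    dimension. *)
Lemma finite_support_image th : equivariant pi N W th ->
  (forall w, W w -> translate pi g W (th w)) ->
  exists2 s : seq G, [set` s] `<=` N &
    forall u, U u -> translate_sum [set` s] U (pi g^-1%g (th u)).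
Proof.
move=> hth thW; have [t Et] := fin_dim_span sU fdU; have UW := translate_sum_sub sN (W := U).
have [smW _] := indN.
have : {in t, forall v, U v} by move=> v; rewrite Et; apply: seq_span_mem.
suff IH (t' : seq V) : {in t', forall v, U v} -> exists2 s : seq G, [set` s] `<=` N &
    forall u, seq_span t' u -> translate_sum [set` s] U (pi g^-1%g (th u)).
  by move=> /IH; rewrite -Et.
elim: t' => [|x t' IHt] Ut.
  exists [::] => // u ->; rewrite (hom0 smW.1 hth) linear0; exact: translate_sum0.
have [|s sNs sth] := IHt; first by move=> y yt; apply: Ut; rewrite inE yt orbT.
have Ux : U x by apply: Ut; rewrite mem_head.
have [s' sNs' sth'] := translate_sum_finite (thW _ (UW _ Ux)).
exists (s ++ s'); first by move=> z /=; rewrite mem_cat => /orP[/sNs|/sNs'].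
move=> u [c su]; have Wd : W (u - c *: x).
  apply: UW; apply: (seq_span_min sU _ su) => y yt; apply: Ut.
  by rewrite inE yt orbT.
have -> : u = c *: x + (u - c *: x) by rewrite addrC subrK.
rewrite (homZD hth)//; last exact: UW.
have sS := translate_sum_subspace [set` s ++ s'] sU.
rewrite linearP; apply: subspaceZD => //.
  by apply: translate_sumS sth' => // z /= zs; rewrite mem_cat zs orbT.
by apply: translate_sumS (sth _ su) => // z /= zs; rewrite mem_cat zs.
Qed.


(** The heart of the matter. A nonzero homomorphism [th] from [W] to its translate by
    [g] embeds [U] into the sum of the translates of [U] by [g * x], for [x] in [N]. Let
    [y] be one of these elements for which the component of [th] is not zero. The image
    of [U] meets finitely many cosets of [P], which [P] permutes, so every [p] in [P] has a
    power fixing the coset [y P], that is, [p ^ y] has a power in [P]. Hence [y]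
    normalizes [P], and the component of [th] in the translate of [U] by [y] identifies
    the two modules. Thus [y] lies in [P], and [g] in [N]. *)
Lemma no_equivariant th : equivariant pi N W th ->
  (forall w, W w -> translate pi g W (th w)) -> ~ nonzero_on W th.
Proof.
move=> hth thW nzth.
have [simW impW] := indN; have [smW _] := simW; have [sW tW] := smW.
have UW := translate_sum_sub sN (W := U).
have sR : is_subspace R by apply: translate_sum_subspace.
have thinj := hom_inj simW hth nzth.
have [u1 Uu1 u10] := nzU.
(* The vectors of [W] without any component form a submodule not containing [U]. *)
have [x [Nx [u0 Uu0 Ru0]]] : exists x, N x /\
    exists2 u, U u & ~ R (pi (g * x)^-1%g (th u)).
  apply: contrapT => noX.
  pose M : set V := W `&` [set w | forall x, N x -> R (pi x^-1%g w)].
  have smM : submodule pi N M.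
    split.
      apply/is_subspaceP; split.
        by split; [exact: subspace0|move=> x _; rewrite linear0; exact: subspace0].
      move=> a v w [Wv Rv] [Ww Rw]; split; first exact: subspaceZD.
      by move=> x Nx; rewrite linearP; apply: subspaceZD => //; [exact: Rv|exact: Rw].
    move=> n w Nn [Ww Rw]; split; first exact: tW.
    move=> x Nx; rewrite -repr_funM -[(x^-1 * n)%g]invgK invgM invgK.
    by apply: Rw; apply: (subgroupM sN) => //; apply: (subgroupV sN).
  have [|M0|WM] := simW.2 _ smM; first by move=> ? [].
    case/eqP: u10; apply: thinj; first exact: UW.
    rewrite -(repr_funVK pi g (th u1)) (M0 (pi g^-1%g (th u1))) ?linear0//.
    split; first by apply: thW; apply: UW.
    move=> x Nx; rewrite -repr_funM -invgM; apply: contrapT => nR; apply: noX.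
    by exists x; split=> //; exists u1.
  case/eqP: u10; apply: impW => //.
  have [_ /(_ _ (subgroup1 sN))] := WM _ (UW _ Uu1).
  by rewrite invg1 repr_fun1.
set y := (g * x)%g in Ru0.
have [s sNs sth] := finite_support_image hth thW.
have nPy : normalizes y P.
  apply: normP => p Pp.
  have tU := smU.2.
  have Ppk k : P (p ^+ k)%g by apply: subgroupX.
  have /choice[z zP] : forall k, exists z : G, z \in s /\ P ((p ^+ k * y)^-1 * (g * z))%g.
    move=> k; apply: contrapT => noz; apply: Ru0.
    have -> : pi y^-1%g (th u0) =
        pi ((p ^+ k * y)^-1 * g)%g (pi g^-1%g (th (pi (p ^+ k)%g u0))).
      rewrite hth.2; [|exact: PN|exact: UW].
      by rewrite -!repr_funM !gnorm.
    apply: translate_sum_act (sth _ (tU _ _ (Ppk k) Uu0)) => h hs; split; last first.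
      by move=> Ph; apply: noz; exists h; split=> //; rewrite mulgA.
    have -> : ((p ^+ k * y)^-1 * g * h = x^-1 * ((p ^- k) ^ g) * h)%g.
      by rewrite /y conjgE !invgM !mulgA.
    apply: (subgroupM sN); last exact: sNs.
    apply: (subgroupM sN); first exact: (subgroupV sN).
    by apply: (nN _).1; apply: PN; apply: (subgroupV sP).
  (* Two powers of [p] move [y P] to the same coset, as [s] is finite. *)
  have /(uniqPn 1%g)[i [j [ij + +]]] : ~~ uniq [seq z k | k <- iota 0 (size s).+1].
    apply/negP => uz; have := @uniq_leq_size _ _ s uz.
    rewrite size_map size_iota ltnn => H.
    suff : false by []; apply: H => _ /mapP[k _ ->]; by have [] := zP k.
  rewrite size_map size_iota => js.
  have nthz k : (k < (size s).+1)%N -> nth 1%g [seq z k | k <- iota 0 (size s).+1] k = z k.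
    by move=> ks; rewrite (nth_map 0%N) ?size_iota// nth_iota.
  rewrite nthz ?(ltn_trans ij)// nthz// => zij.
  apply: (isoP (n := (j - i.+1)%N)).
  have -> : ((p ^ y) ^+ (j - i.+1).+1 = ((p ^+ i * y)^-1 * (g * z i)) *
      ((p ^+ j * y)^-1 * (g * z j))^-1)%g.
    have -> : (p ^+ j = p ^+ i * p ^+ (j - i))%g by rewrite -expgnDr subnKC// ltnW.
    rewrite subnSK// -zij -conjXg conjgE; move: (p ^+ (j - i))%g (p ^+ i)%g => q q'.
    by rewrite !gnorm.
  by apply: (subgroupM sP); [have [] := zP i|apply: (subgroupV sP); have [] := zP j].
have [sR' tR] : submodule pi P R.
  by split=> //; apply: translate_sum_setD_stable.
have [sY tY] := translate_submodule nPy smU.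
have [||u Uu|v' [Yv Rv]|et het Tet] := @hom_of_rel _ _ _ pi P U
    (fun u v => translate pi y U v /\ R (pi y^-1%g (th u - v))) smU.
- move=> a u v u' v' Uu Uv [Yu Ru] [Yv Rv]; split; first exact: subspaceZD.
  rewrite (homZD hth); [|exact: UW|exact: UW].
  by rewrite opprD addrACA -scalerBr linearP; apply: subspaceZD.
- move=> p u v Pp Uu [Yu Ru]; split; first exact: tY.
  rewrite hth.2; [|exact: PN|exact: UW].
  by rewrite -linearB repr_funVJ; apply: tR => //; apply: (nPy _ Pp).1.
- have Wu : W (pi y^-1%g (th u)).
    rewrite invgM repr_funM; apply: tW; first exact: (subgroupV sN).
    by apply: thW; apply: UW.
  have [u' Uu' Ru'] := translate_sum_split sP smU Wu.
  exists (pi y u'); split; first exact: translate_mem.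
  by rewrite linearB repr_funK.
- move: Rv; rewrite (hom0 smW hth) sub0r linearN => /(subspaceN sR); rewrite opprK => Rv.
  by rewrite -(repr_funVK pi y v') (impW _ Yv Rv) linear0.
apply: Ng; suff Py : P y.
  have -> : g = (y * x^-1)%g by rewrite /y mulgK.
  by apply: (subgroupM sN); [exact: PN|exact: (subgroupV sN)].
apply: (selfP nPy het); last by move=> u /Tet[].
exists u0 => //; apply/eqP => et0; have [_] := Tet _ Uu0.
by rewrite et0 subr0.
Qed.

End NoHom.

(** By [no_equivariant] the translates of [W] by the cosets of [N] in [L] are simple
    and pairwise not isomorphic over the normal subgroup [N]. Hence their sum is
    direct, and a nonzero [L]-submodule, containing a copy of one of them, contains
    them all. *)
Lemma irreducibly_induced_step N L : is_subgroup N -> is_subgroup L ->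
  P `<=` N -> N `<=` L -> (forall g, L g -> normalizes g N) ->
  irreducibly_induced N -> irreducibly_induced L.
Proof.
move=> sN sL PN NL nLN indN; have [simW impW] := indN.
set W := translate_sum N U in simW.
have [[sW tW] _] := simW; have smW := simW.1.
have WL : translate_sum L W = translate_sum L U.
  apply/seteqP; split; last by apply: translate_sumS => //; apply: translate_sum_sub.
  apply: translate_sum_min; first exact: translate_sum_subspace.
  by move=> g w Lg; apply: translate_sum_act => h /NL; apply: (subgroupM sL).
have no g th : L g -> ~ N g -> equivariant pi N W th ->
    (forall w, W w -> translate pi g W (th w)) -> ~ nonzero_on W th.
  by move=> Lg Ng; apply: no_equivariant => //; apply: nLN.
have sim_tr s : [set` s] `<=` L ->
    {in [seq translate pi g W | g <- s], forall Y, simple_or_zero pi N Y}.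
  move=> sNL _ /mapP[g gs ->]; apply: translate_simple => //.
  by apply: nLN; apply: sNL.
have submod_tr s Z : [set` s] `<=` L -> submodule pi N Z ->
    submodule pi N (sum_modules Z [seq translate pi g W | g <- s]).
  by move=> sNL smZ; apply: sum_modules_submodule => // Y /(sim_tr _ sNL)[].
(* A nonzero [N]-submodule of the sum receives a copy of some translate; moved back
   by [g] the copy becomes a copy of [W]. *)
have copy (A : set G) M v : A `<=` L -> submodule pi N M -> M v -> v != 0 ->
    translate_sum A W v -> exists2 g, A g & exists th,
    [/\ equivariant pi N W th, nonzero_on W th & forall w, W w -> M (pi g (th w))].
  move=> AL smM Mv v0 /translate_sum_finite[s sA].
  move=> /(translate_sum_modules sW (@subspace_set0 _ _)) sv.
  have sL' : [set` s] `<=` L by move=> g /sA/AL.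
  have [||Y /mapP[g gs ->] [th [hth [w Ww thw] thM]]] := simple_sub_of_sum (sim_tr _ sL')
      (submoduleI smM (submod_tr _ _ sL' (@submodule0 _ _ _ pi N))).
  - by exists v.
  - exact: subIsetr.
  have Lg : L g by apply: sL'.
  exists g; first exact: sA.
  exists (fun u => pi g^-1%g (th (pi g u))); split.
  - have := hom_conj (normalizesV (nLN _ Lg)) (translate_submodule (nLN _ Lg) smW) hth.
    rewrite invgK; apply: homS => u Wu.
    by rewrite /translate /= invgK repr_funK.
  - exists (pi g^-1%g w) => //; rewrite repr_funVK; apply: contra_neq thw.
    exact: repr_eq0.
  - by move=> u Wu; rewrite repr_funVK; apply: (thM _ _).1; apply: translate_mem.
have imp : imprimitive L N W.
  move=> w Ww Lw; apply/eqP; case: eqP => // /eqP w0.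
  have [|g [Lg Ng] [th [hth nzth thW]]] := copy _ _ _ _ smW Ww w0 Lw; first by move=> ? [].
  case: (@no g^-1%g th _ _ hth _ nzth).
  - exact: subgroupV.
  - by move=> /(subgroupV sN); rewrite invgK.
  - by move=> u Wu; rewrite /translate /= invgK; apply: thW.
split; last exact: (imprimitive_trans sN PN NL sU impW imp).
split=> [|M smM ML]; first exact: translate_sum_submodule.
have [nzM|/nonzeroPn] := pselect (nonzero M); last by left.
right; have [sM tM] := smM; have [v Mv v0] := nzM.
have := ML _ Mv; rewrite -WL => Lv.
have smM' := submoduleS NL smM.
have [g Lg [th [hth [w1 Ww1 thw1] thM]]] := copy L M v (@subset_refl _ _) smM' Mv v0 Lv.
have {}thM w : W w -> M (th w).
  by move=> /thM /(tM _ _ (subgroupV sL Lg)); rewrite repr_funK.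
have [s sLN sv] : exists2 s : seq G, [set` s] `<=` L `\` N & forall w, W w ->
    sum_modules W [seq translate pi g W | g <- s] (th w).
  have := ML _ (thM _ Ww1); rewrite -WL => /(translate_sum_split sN smW)[w Ww].
  move=> /translate_sum_finite[s sLN] /(translate_sum_modules sW sW) sw.
  exists s => //; have sL' : [set` s] `<=` L by move=> h /sLN[].
  have smS := submod_tr _ _ sL' smW.
  have [|S0 |WS] := simW.2 _ (hom_preimage smW hth smS); first by move=> ? [].
    case/eqP: thw1; rewrite (S0 w1) ?(hom0 smW hth)//; split=> //=.
    rewrite -(subrK w (th w1)); apply: (subspaceD smS.1) => //.
    apply: sum_modules_base Ww => _ /mapP[h _ ->]; exact: translate_subspace.
  by move=> u Wu; apply: (WS _ Wu).2.
have thW : forall w, W w -> W (th w).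
  apply: (hom_to_sum smW smW _ _ hth sv); first by apply: sim_tr => h /sLN[].
  move=> _ /mapP[h /sLN[Lh Nh] ->] [et [het nzet etY]].
  exact: (no h et).
rewrite -(hom_onto smW simW hth _ thW); last by exists w1.
apply: translate_sum_min => // h _ Lh [w Ww <-]; apply: tM => //; exact: thM.
Qed.

End CliffordStep.
End Imprimitivity.

(** * Eigenvectors *)

Section Eigenvectors.
Variables (F : closedFieldType) (V : lmodType F) (f : {linear V -> V}).
Implicit Types (p q : {poly F}) (v w : V) (W : set V).

Definition poly_act p v := \sum_(i < size p) p`_i *: iter i f v.

Lemma poly_act_widen n p v : (size p <= n)%N ->
  poly_act p v = \sum_(i < n) p`_i *: iter i f v.
Proof.
move=> pn; rewrite /poly_act (big_ord_widen n (fun i => p`_i *: iter i f v)) //.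
rewrite big_mkcond; apply: eq_bigr => i _; case: ltnP => // /(nth_default 0) ->.
by rewrite scale0r.
Qed.

Lemma poly_act_XsubC c q v :
  poly_act (('X - c%:P) * q) v = f (poly_act q v) - c *: poly_act q v.
Proof.
rewrite (@poly_act_widen (size q).+1); last first.
  by apply: leq_trans (size_polyMleq _ _) _; rewrite size_XsubC.
rewrite (eq_bigr (fun i : 'I__ => ('X * q)`_i *: iter i f v - c *: (q`_i *: iter i f v))).
  rewrite sumrB -scaler_sumr -(poly_act_widen _ (leqnSn _)); congr (_ - _).
  rewrite big_ord_recl coefXM eqxx scale0r add0r linear_sum; apply: eq_bigr => i _.
  by rewrite coefXM /= linearZ.
by move=> i _; rewrite mulrBl coefB coefCM scalerBl scalerA.
Qed.

(** A root of an annihilating polynomial of least degree is an eigenvalue. *)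
Lemma poly_act_eigenvector p v : p != 0 -> v != 0 -> poly_act p v = 0 ->
  exists c q, poly_act q v != 0 /\ f (poly_act q v) = c *: poly_act q v.
Proof.
elim: {p}_.+1 {-2}p (ltnSn (size p)) => // n IHn p pn p0 v0 pv.
have p1 : size p != 1.
  apply/negP => /size_poly1P[c c0 Ep]; move: pv.
  rewrite /poly_act Ep size_polyC c0 big_ord1 coefC /= => /eqP.
  by rewrite scaler_eq0 (negPf c0) (negPf v0).
have [c /factor_theorem[q Ep]] := closed_rootP p p1.
have q0 : q != 0 by apply: contraNneq p0 => q0; rewrite Ep q0 mul0r.
have [qv0|qv] := eqVneq (poly_act q v) 0.
  apply: (IHn q) => //; move: pn.
  by rewrite Ep size_Mmonic ?monicXsubC// size_XsubC addn2 /= ltnS.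
by exists c, q; split=> //; move: pv; rewrite Ep mulrC poly_act_XsubC => /subr0_eq.
Qed.

Lemma poly_act_mem W p v : is_subspace W -> (forall w, W w -> W (f w)) -> W v ->
  W (poly_act p v).
Proof.
move=> sW fW Wv; apply: subspace_sum => // i _; apply: subspaceZ => //.
by elim: (nat_of_ord i) => //= n; apply: fW.
Qed.

Lemma fin_dim_eigenvector W : is_subspace W -> fin_dim W -> nonzero W ->
  (forall w, W w -> W (f w)) -> exists c w, [/\ W w, w != 0 & f w = c *: w].
Proof.
move=> sW [s Ws] [v Wv v0] fW.
have [|c [i i_n ci] sum0] := @seq_span_dependent _ V s (size s).+1 (fun i => iter i f v) (ltnSn _).
  by move=> i _; apply: Ws; elim: i => //= i; apply: fW.
pose p := \poly_(i < (size s).+1) c i.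
have [||d [q [qv fqv]]] := @poly_act_eigenvector p v _ v0.
- by apply/eqP => /polyP/(_ i); rewrite coef_poly i_n coef0 => /eqP; apply/negP.
- rewrite (@poly_act_widen (size s).+1) ?size_poly// -[RHS]sum0; apply: eq_bigr => j _.
  by rewrite coef_poly ltn_ord.
by exists d, (poly_act q v); split=> //; apply: poly_act_mem.
Qed.

Definition prod_act (s : seq F) v := foldr (fun c w => f w - c *: w) v s.

Lemma prod_actB s c v : prod_act s (f v - c *: v) = f (prod_act s v) - c *: prod_act s v.
Proof.
elim: s => //= d s ->; rewrite !(linearB f) !(linearZZ f) /= !scalerBr !scalerA (mulrC d).
by rewrite !opprB -!addrA; congr (_ + _); rewrite addrC addrAC addrC.
Qed.

Lemma prod_act_eigenvector s c v : f v = c *: v ->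
  prod_act s v = (\prod_(d <- s) (c - d)) *: v.
Proof.
move=> fv; elim: s => [|d s IHs]; first by rewrite big_nil scale1r.
by rewrite /= IHs linearZZ fv !scalerA -scalerBl big_cons mulrBl (mulrC c).
Qed.

End Eigenvectors.

(** * Simple modules of finite dimension are monomial *)

Section FiniteDimensional.
Variables (F : closedFieldType) (G : groupType) (V : lmodType F).
Variable pi : representation G V.
Implicit Types (P H L : set G) (W M U : set V).
Local Notation translate_sum := (translate_sum pi).

(** The product of the [a - d], over the eigenvalues [d] that occur in the sum, kills
    [v], but it multiplies eigenvectors for [c] by a nonzero scalar. *)
Lemma eigenvector_translate_sum (a : G) (A : set G) c W v :
  (forall g w, A g -> W w -> exists2 d, d != c & pi a (pi g w) = d *: pi g w) ->
  translate_sum A W v -> pi a v = c *: v -> v = 0.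
Proof.
move=> AW Av av.
have [s sc sv] : exists2 s, c \notin s & prod_act (pi a) s v = 0.
  elim: Av => [|g w u Ag Ww _ [s sc su]]; first by exists [::].
  have [d dc ad] := AW _ _ Ag Ww; exists (rcons s d).
    by rewrite mem_rcons inE negb_or eq_sym dc.
  rewrite /prod_act -cats1 foldr_cat /= linearD ad scalerDr opprD addrACA subrr add0r.
  by rewrite -/(prod_act _ _ _) prod_actB su linear0 scaler0 subrr.
move: sv; rewrite (prod_act_eigenvector _ av) => /eqP; rewrite scaler_eq0.
case/orP => [|/eqP//]; rewrite prodf_seq_eq0 => /hasP[d ds /=].
by rewrite subr_eq0 => /eqP cd; rewrite cd ds in sc.
Qed.

Lemma seq_span1P (u v : V) : seq_span [:: u] v <-> exists c, v = c *: u.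
Proof.
by split=> -[c /eqP]; [rewrite subr_eq0|rewrite -subr_eq0] => /eqP; exists c.
Qed.

Lemma exists_simple P W : submodule pi P W -> fin_dim W -> nonzero W ->
  exists U, [/\ simple_or_zero pi P U, nonzero U & U `<=` W].
Proof.
move=> [sW tW] fW nzW; move: W sW fW tW nzW.
apply: fin_dim_ind => W sW fW IH tW nzW.
have [simW|] := pselect (simple_or_zero pi P W); first by exists W; split.
move=> /not_andP[[]//|/existsNP[M /not_implyP[[sM tM] /not_implyP[MW]]]].
move=> /not_orP[/not_sub0 nzM WM].
have [U [simU nzU UM]] := IH M sM MW WM tM nzM.
by exists U; split=> // u /UM/MW.
Qed.

(** The classical argument for finite groups. If [P] does not act by scalars, choose
    [a] in [P] not acting by a scalar, as deep as possible in the lower central series.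
    The commutators of [a] with [P] act by scalars, hence [P] permutes the eigenspaces
    of [a], and [U] is induced from the stabilizer [S] of one of them, [E], which is a
    simple [S]-module of smaller dimension. *)
Lemma fin_dim_monomial : nilpotent_group G -> forall U, is_subspace U -> fin_dim U ->
  forall P, is_subgroup P -> simple_or_zero pi P U -> nonzero U ->
  exists H u, [/\ is_subgroup H /\ H `<=` P, U u, u != 0,
    forall h, H h -> exists c, pi h u = c *: u & imprimitive pi P H (seq_span [:: u])].
Proof.
move=> [N nilN]; apply: fin_dim_ind => U sU fU IH P sP simU nzU.
have [u0 Uu0 u00] := nzU; have [[_ tU] _] := simU.
pose scalar k := forall g, P g -> lower_central k g ->
  exists c, forall u, U u -> pi g u = c *: u.
have [sc0|nsc0] := pselect (scalar 0%N).
  exists P, u0; split=> // [|h Ph|w _]; first by split.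
    by have [c hc] := sc0 h Ph I; exists c; apply: hc.
  by elim=> // g w' v [].
have [k nsck sck] : exists2 k, ~ scalar k & scalar k.+1.
  have : scalar N by move=> g _; rewrite nilN => ->; exists 1 => u _; rewrite repr_fun1 scale1r.
  elim: N {nilN} => // n IHn sn; have [/IHn //|nsn] := pselect (scalar n).
  by exists n.
have [a Pa [ka nsa]] : exists2 a, P a &
    lower_central k a /\ forall c, ~ forall u, U u -> pi a u = c *: u.
  apply: contrapT => noa; apply: nsck => g Pg kg; apply: contrapT => noc; apply: noa.
  by exists g => //; split=> // c hc; apply: noc; exists c.
have [c [w [Uw w0 aw]]] := fin_dim_eigenvector sU fU nzU (fun u => tU _ u Pa).
have c0 : c != 0.
  apply: contra_neq w0 => c0; move: aw; rewrite c0 scale0r; exact: repr_eq0.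
pose E : set V := U `&` [set u | pi a u = c *: u].
have sE : is_subspace E.
  apply: subspaceI => //; apply/is_subspaceP; split; first by rewrite /= linear0 scaler0.
  by move=> d x y /= ax ay; rewrite linearP ax ay scalerDr !scalerA mulrC.
pose S : set G := P `&` [set p | forall u, U u -> pi a (pi p u) = pi p (pi a u)].
have sS : is_subgroup S.
  apply/is_subgroupP; split; first by split=> [|u _]; rewrite ?repr_fun1//; exact: subgroup1.
  move=> x y [Px ax] [Py ay]; have Pyi := subgroupV sP Py.
  split=> [|u Uu]; first exact: subgroupM.
  rewrite !repr_funM ax; last exact: tU.
  congr (pi x _); apply: (can_inj (repr_funK pi y)).
  by rewrite -ay ?repr_funVK//; exact: tU.
have SP : S `<=` P by move=> x [].
have other p u : (P `\` S) p -> E u -> exists2 d, d != c & pi a (pi p u) = d *: pi p u.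
  move=> [Pp nSp] [Uu au].
  have [d ad] : exists d, forall v, U v -> pi [~ a, p]%g v = d *: v.
    apply: sck; first by rewrite commgEl; apply: (subgroupM sP (subgroupV sP Pa)); apply: subgroupJ.
    by rewrite lower_central_lcs; apply: lcs_commg; rewrite -?lower_central_lcs.
  have apv v : U v -> pi a (pi p v) = d *: pi p (pi a v).
    by move=> Uv; rewrite -repr_funM (commgC a p) (repr_funM pi (p * a)%g) ad// linearZZ repr_funM.
  exists (d * c); last by rewrite apv// au linearZ scalerA.
  apply: contra_notN nSp => /eqP dc; split=> // v Uv.
  have d1 : d = 1 by apply: (mulIf c0); rewrite mul1r.
  by rewrite apv// d1 scale1r.
have impE : imprimitive pi P S E.
  by move=> u [Uu au] Su; apply: eigenvector_translate_sum Su au.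
have tE : stable pi S E.
  move=> p u [Pp ap] [Uu au]; split; first exact: tU.
  by rewrite /= ap// au linearZ.
have nzE : nonzero E by exists w.
have simE : simple_or_zero pi S E.
  split=> // M smM ME; have [nzM|/nonzeroPn] := pselect (nonzero M); last by left.
  right=> x [Ux ax].
  have := translate_sum_simple sP simU smM.1 (fun m Mm => (ME m Mm).1) nzM.
  move=> /seteqP[_ /(_ _ Ux)] /(translate_sum_split sS smM)[m Mm Smx].
  rewrite -(subrK m x) (impE (x - m)) ?add0r//; first by apply: subspaceB => //; exact: ME.
  exact: translate_sumS Smx.
have [||H [u [[sH HS] Eu u_0 hu impu]]] := IH E sE _ _ S sS simE nzE; first exact: subIsetl.
  by move=> UE; apply: (nsa c) => u /UE[].
have sL := seq_span_subspace [:: u].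
have LE : seq_span [:: u] `<=` E.
  by apply: seq_span_min => // x; rewrite inE => /eqP->.
have nzL : nonzero (seq_span [:: u]) by exists u => //; apply: seq_span_mem; exact: mem_head.
exists H, u; split=> //; first by split=> // x /HS/SP.
  by have [] := Eu.
apply: (imprimitive_trans sS HS SP sL impu).
by rewrite (translate_sum_simple sS simE sL LE nzL).
Qed.

End FiniteDimensional.

(** * Extending a module of finite multiplicity *)

Section Weighted.
Variables (F : closedFieldType) (G : groupType) (V : lmodType F).
Variable pi : representation G V.
Implicit Types (P H L : set G) (W M U E : set V) (g : G) (th : V -> V).
Local Notation translate_sum := (translate_sum pi).

(** The existence of [E] means that the space of homomorphisms from [U] to [V] has
    finite dimension. For [U] of dimension one this is the finiteness of a weight
    space. *)
Definition finite_multiplicity P U E :=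
  [/\ simple_or_zero pi P U, nonzero U, fin_dim U, fin_dim E &
    forall th, equivariant pi P U th -> forall u, U u -> E (th u)].

Section Extension.
Variables (P : set G) (U E : set V) (g : G) (n : nat) (et : V -> V).
Hypotheses (sP : is_subgroup P) (nP : normalizes g P).
Hypothesis fmU : finite_multiplicity P U E.
Hypotheses (het : equivariant pi P U et) (nzet : nonzero_on U et).
Hypothesis etU : forall u, U u -> translate pi (g ^+ n.+1)%g U (et u).

(* [copies] spans the isotypic component of [U], and [W] is the sum of its translates
   by the powers of [g]. *)
Let copies : set V := [set v | exists th, equivariant pi P U th /\ exists2 u, U u & th u = v].
Let powers : set G := [set h | exists2 k, (k < n.+1)%N & h = (g ^+ k)%g].
Let W : set V := translate_sum powers copies.

Let sW : is_subspace W.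
Proof.
apply: translate_sum_scalable => c _ [th [hth [u Uu <-]]].
have [[smU _] _ _ _ _] := fmU; have U0 := subspace0 smU.1.
exists th; split=> //; exists (c *: u); first exact: subspaceZ smU.1 _ _ Uu.
by rewrite -(addr0 (c *: u)) (homZD hth)// (hom0 smU hth) addr0.
Qed.

Let fW : fin_dim W.
Proof.
have [_ _ _ [s Es] EU] := fmU.
exists (flatten [seq [seq pi (g ^+ k)%g e | e <- s] | k <- iota 0 n.+1]).
apply: translate_sum_min; first exact: seq_span_subspace.
move=> _ _ [k kn ->] [th [hth [u Uu <-]]].
have /Es := EU _ hth _ Uu; move: (th u) => v sv.
apply: (seq_span_min (subspace_preimage (pi (g ^+ k)%g) (seq_span_subspace _)) _ sv).
move=> e es; apply: seq_span_mem; apply/flatten_mapP; exists k.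
  by rewrite mem_iota.
exact: map_f.
Qed.

Let WP : stable pi P W.
Proof.
move=> p w Pp; apply: (translate_sum_min (subspace_preimage (pi p) sW)).
move=> _ _ [k kn ->] [th [hth [u Uu <-]]].
have Ppg := (normalizesX k nP Pp).1; have [[[_ tU] _] _ _ _ _] := fmU.
rewrite /= repr_funJ -hth.2//; apply: translate_sum_mem; first by exists k.
by exists th; split=> //; exists (pi (p ^ (g ^+ k))%g u); first exact: tU.
Qed.

(* [et] identifies the [n.+1]-st translate of [U] with [U], which closes up the
   orbit of the isotypic component under [g]. *)
Let Wg w : W w -> W (pi g w).
Proof.
apply: (translate_sum_min (subspace_preimage (pi g) sW)).
have [simU nzU _ _ _] := fmU; have smU := simU.1.
move=> _ _ [k kn ->] [th [hth [u Uu <-]]]; rewrite /= -repr_funM -expgS.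
have [kn'|] := ltnP k.+1 n.+1.
  apply: translate_sum_mem; first by exists k.+1.
  by exists th; split=> //; exists u.
move=> nk; have -> : k.+1 = n.+1 by apply/eqP; rewrite eqn_leq kn.
set h := (g ^+ n.+1)%g; have nh : normalizes h P by apply: normalizesX.
have etE : [set et w | w in U] = translate pi h U.
  exact: (hom_onto smU (translate_simple nh simU) het nzet etU).
rewrite -(repr_fun1 pi (pi h _)); apply: translate_sum_mem; first by exists 0%N.
exists ((fun v => pi h (th (pi h^-1%g v))) \o et); split.
  by apply: hom_comp het (hom_conj nh smU hth) _ => v; apply: etU.
have : translate pi h U (pi h u) by apply: translate_mem.
by rewrite -etE => -[u' Uu' etu']; exists u' => //=; rewrite etu' repr_funK.
Qed.

Let smW : submodule pi (cyclic_extension g P) W.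
Proof.
split=> // x w + Ww; pose S := [set x | (forall w, W w -> W (pi x w)) /\
  (forall w, W w -> W (pi x^-1%g w))].
have sS : is_subgroup S.
  apply/is_subgroupP; split; first by split=> v; rewrite ?invg1 repr_fun1.
  move=> a b [aW aW'] [bW bW']; split=> v Wv; rewrite ?invgM repr_funM.
    by apply/aW/bW'.
  by rewrite invgK; apply/bW/aW'.
suff /(_ x) : cyclic_extension g P `<=` S by move=> /[apply] -[+ _]; apply.
apply: cyclic_extension_min => //.
  by move=> p Pp; split=> v; apply: WP => //; apply: subgroupV.
split; first exact: Wg.
exact: (fin_dim_surj (repr_funK pi g) (repr_funVK pi g) sW fW Wg).
Qed.

Let W_modules w : W w -> exists2 Ys : seq (set V),
  {in Ys, forall Y, exists k th, [/\ (k < n.+1)%N, equivariant pi P U th &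
    Y = translate pi (g ^+ k)%g [set th u | u in U]]} &
  sum_modules [set 0] Ys w.
Proof.
elim=> [|h v u [k kn ->] [th [hth [x Ux <-]]] _ [Ys HYs Ysu]]; first by exists [::].
exists (translate pi (g ^+ k)%g [set th u | u in U] :: Ys).
  by move=> Y; rewrite inE => /orP[/eqP->|/HYs//]; exists k, th.
exists (pi (g ^+ k)%g (th x)); first by apply: translate_mem; exists x.
by rewrite addrAC subrr add0r.
Qed.

(** [W] is a module of finite dimension over the larger group, and a simple submodule
    [U'] of [W] contains, as a [P]-module, a copy of a translate of [U]. A homomorphism
    defined on [U'] sends this copy to another one, hence into [W]; as [U'] is simple,
    it sends all of [U'] into [W]. *)
Lemma finite_multiplicity_extension :
  exists U' E', finite_multiplicity (cyclic_extension g P) U' E'.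
Proof.
have [simU [u1 Uu1 u10] _ _ _] := fmU.
have UW : U `<=` W.
  move=> u Uu; rewrite -(repr_fun1 pi u); apply: translate_sum_mem; first by exists 0%N.
  by exists id; split=> //; exists u.
have [|U' [simU' nzU' U'W]] := exists_simple smW fW; first by exists u1 => //; apply: UW.
exists U', W; split=> // [|th hth]; first exact: fin_dimS U'W fW.
have PQ := @cyclic_extension_sub _ g P.
have [u' Uu' u'0] := nzU'.
have [Ys HYs Ysu'] := W_modules (U'W _ Uu').
have simYs : {in Ys, forall Y, simple_or_zero pi P Y}.
  move=> _ /HYs[k [th' [_ hth' ->]]]; apply: translate_simple; first exact: normalizesX.
  exact: hom_image_simple.
have smS : submodule pi P (sum_modules [set 0] Ys).
  by apply: sum_modules_submodule => [|Y /simYs[]//]; exact: submodule0.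
have smU' := submoduleS PQ simU'.1.
have [||Y Y_Ys [ze [hze [y1 Yy1 zey1] zeU']]] :=
    simple_sub_of_sum simYs (submoduleI smU' smS).
- by exists u'.
- exact: subIsetr.
have zeU'1 y : Y y -> U' (ze y) by move=> /zeU'[].
have [k [th' [kn hth' EY]]] := HYs _ Y_Ys.
have thze y : Y y -> W (th (ze y)).
  rewrite EY => -[u Uu thu].
  have nh := normalizesX k nP; set h := (g ^+ k)%g in EY nh thu *.
  have -> : y = pi h (th' u) by rewrite thu repr_funVK.
  rewrite -(repr_funVK pi h (th _)); apply: translate_sum_mem; first by exists k.
  exists ((fun v => pi h^-1%g ((th \o ze) (pi (h^-1)^-1%g v))) \o th'); split; last first.
    by exists u => //=; rewrite invgK.
  have smY := (simYs _ Y_Ys).1.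
  apply: (hom_comp hth' (hom_conj (normalizesV nh) smY _)).
    by apply: hom_comp hze _ zeU'1; apply: hom_sub hth.
  by move=> v Uv; rewrite EY /translate /= invgK repr_funK; exists v.
have [|W0|WU' u Uu] := simU'.2 _ (hom_preimage simU'.1 hth smW); first by move=> ? [].
  by case/eqP: zey1; apply: W0; split; [exact: zeU'1|exact: thze].
exact: (WU' _ Uu).2.
Qed.

End Extension.
End Weighted.

(** * A subnormal series above a subgroup *)

Section CentralProducts.
Variable G : groupType.
Variable P : set G.
Hypothesis sP : is_subgroup P.
Local Open Scope group_scope.

(** The subgroup [P * lower_central n]. For decreasing [n] these subgroups lead from
    [P] to the whole group, each one normal in the next. *)
Definition central_product n : set G :=
  [set x | exists2 p, P p & lower_central n (p^-1 * x)].

Lemma central_productP n x : central_product n x <->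
  exists p c, [/\ P p, lower_central n c & x = p * c].
Proof.
split=> [[p Pp nx]|[p [c [Pp nc ->]]]]; last by exists p; rewrite ?mulKg.
by exists p, (p^-1 * x); rewrite mulVKg.
Qed.

Lemma central_product_subgroup n : is_subgroup (central_product n).
Proof.
have sL := lcs_subgroup (subgroup_setT G) n.
apply/is_subgroupP; split.
  exists 1; first exact: subgroup1.
  by rewrite mulVg lower_central_lcs; apply: (subgroup1 sL).
move=> _ _ /central_productP[p [c [Pp nc ->]]] /central_productP[q [d [Pq nd ->]]].
have Pqi := subgroupV sP Pq; exists (p * q^-1); first exact: subgroupM.
have -> : (p * q^-1)^-1 * (p * c * (q * d)^-1) = (c * d^-1) ^ q^-1.
  by rewrite conjgE !gnorm.
rewrite lower_central_lcs in nc nd *; apply: (lcsJ (subgroup_setT G)) => //.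
exact: (subgroupM sL nc (subgroupV sL nd)).
Qed.

Lemma central_product_sub n : P `<=` central_product n.
Proof.
move=> p Pp; exists p => //; rewrite mulVg lower_central_lcs.
exact: (subgroup1 (lcs_subgroup (subgroup_setT G) n)).
Qed.

Lemma central_product_full : central_product 0 = setT.
Proof. by apply/seteqP; split=> // x _; exists 1; rewrite //; exact: subgroup1. Qed.

Lemma central_product_trivial n : @lower_central G n = [set 1] -> central_product n = P.
Proof.
move=> n1; apply/seteqP; split; last exact: central_product_sub.
by move=> x [p Pp]; rewrite n1 => /(canRL (mulVKg p)); rewrite mulg1 => ->.
Qed.

Lemma central_productS n : central_product n.+1 `<=` central_product n.
Proof.
move=> x [p Pp nx]; exists p => //; move: nx; rewrite !lower_central_lcs.
exact: (lcsS (subgroup_setT G)).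
Qed.

Lemma central_product_normalizes n g :
  central_product n g -> normalizes g (central_product n.+1).
Proof.
have sC := central_product_subgroup n.+1.
suff CJ h x : central_product n h -> central_product n.+1 x -> central_product n.+1 (x ^ h).
  move=> Cg x Cx; split; apply: CJ => //.
  exact: subgroupV (central_product_subgroup n) Cg.
move=> /central_productP[q [c [Pq nc ->]]] Cx; rewrite conjgM.
have Cxq : central_product n.+1 (x ^ q).
  by apply: (subgroupJ sC) => //; apply: central_product_sub.
have -> : (x ^ q) ^ c = x ^ q * [~ c, x ^ q]^-1 by rewrite invgR commgEl mulVKg.
apply: (subgroupM sC) => //; apply: (subgroupV sC); exists 1; first exact: subgroup1.
rewrite invg1 mul1g lower_central_lcs; apply: lcs_commg => //.
by rewrite -lower_central_lcs.
Qed.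

End CentralProducts.

(** Otherwise the subgroups conjugate to [P] under the powers of [y^-1] would form a
    strictly increasing sequence. *)
Lemma conj_sub_normalizes (G : groupType) (P : set G) (y : G) :
  maximal_condition [set: G] -> is_subgroup P ->
  (forall p, P p -> P (p ^ y)%g) -> normalizes y P.
Proof.
move=> maxG sP PJ p Pp; split; first exact: PJ.
pose Q k : set G := [set x | P (x ^ (y ^+ k))%g].
have [||_ [k _ <-] maxQ] := maxG [set Q k | k in setT].
- by exists (Q 0%N), 0%N.
- move=> _ [k _ <-]; apply/is_subgroupP; split.
    by rewrite /Q /= conj1g; apply: subgroup1.
  move=> u v; rewrite /Q /= => Pu Pv; rewrite conjMg conjVg.
  by apply: (subgroupM sP) => //; apply: (subgroupV sP).
have : Q k (p ^ (y ^- k.+1))%g.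
  apply: (maxQ (Q k.+1)); first by exists k.+1.
    by move=> x Qx; rewrite /Q /= expgSr conjgM; apply: PJ.
  by split=> //; rewrite /Q /= -conjgM mulVg conjg1.
by rewrite /Q /= -conjgM expgSr invgM -mulgA mulVg mulg1.
Qed.

(** * Representations of finite weight are monomial *)

Section FiniteWeightMonomial.
Variables (F : closedFieldType) (G : groupType) (V : lmodType F).
Variable pi : representation G V.
Implicit Types (P H : set G) (U E : set V).
Local Notation translate_sum := (translate_sum pi).

(** Among the subgroups with a module of finite multiplicity take a maximal one, [P].
    By [finite_multiplicity_extension] no larger subgroup generated by [P] and an
    element normalizing [P] has such a module, which provides the hypotheses of
    [irreducibly_induced_step]. This lemma is then applied along the subnormal series
    from [P] to [G]. *)
Lemma exists_irreducibly_induced P0 U0 E0 :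
  finitely_generated G -> nilpotent_group G ->
  is_subgroup P0 -> finite_multiplicity pi P0 U0 E0 ->
  exists P U, [/\ is_subgroup P, simple_or_zero pi P U, nonzero U, fin_dim U &
    imprimitive pi setT P U].
Proof.
move=> fgG nilG sP0 fm0; have maxG := maximal_condition_fg_nilpotent fgG nilG.
have [||P [sP [U [E fmU]]] maxP] :=
    maxG [set P | is_subgroup P /\ exists U E, finite_multiplicity pi P U E].
- by exists P0; split=> //; exists U0, E0.
- by move=> P [].
have [simU nzU fU _ _] := fmU; have [[sU tU] _] := simU.
have ext g n et : normalizes g P -> equivariant pi P U et -> nonzero_on U et ->
    (forall u, U u -> translate pi (g ^+ n.+1)%g U (et u)) -> P g.
  move=> nP het nzet etU; apply: (maxP (cyclic_extension g P)).
  - split; first exact: cyclic_extension_subgroup.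
    exact: (finite_multiplicity_extension sP nP fmU het nzet etU).
  - exact: cyclic_extension_sub.
  - by split=> //; apply: cyclic_extension_mem.
have [u1 Uu1 u10] := nzU.
have isoP : forall x n, P (x ^+ n.+1)%g -> P x.
  apply: (isolated_of_normalizer nilG sP) => g n nP Pgn.
  apply: (ext g n id) => //.
  by move=> u; rewrite (translate_stable simU.1 Pgn).
have normP y : (forall p, P p -> P (p ^ y)%g) -> normalizes y P.
  exact: conj_sub_normalizes.
have selfP y th : normalizes y P -> equivariant pi P U th -> nonzero_on U th ->
    (forall u, U u -> translate pi y U (th u)) -> P y.
  by move=> nP hth nzth thU; apply: (ext y 0%N th).
exists P, U; split=> //; have [N nilN] := nilG.
have UP : translate_sum P U = U by apply: (translate_sum_simple sP simU).
have ind k : irreducibly_induced pi P U (central_product P (N - k)).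
  elim: k => [|k IHk].
    rewrite subn0 central_product_trivial// /irreducibly_induced UP; split=> // u _.
    by elim=> // g w v [].
  have [Nk|kN] := leqP N k; first by move: IHk; rewrite subnS (eqP Nk).
  apply: (irreducibly_induced_step sP simU nzU fU isoP normP selfP
    (N := central_product P (N - k.+1).+1)).
  - exact: central_product_subgroup.
  - exact: central_product_subgroup.
  - exact: central_product_sub.
  - exact: central_productS.
  - by move=> g; apply: central_product_normalizes.
  - by rewrite subnSK.
by have [_] := ind N; rewrite subnn central_product_full.
Qed.

Section Coordinate.
Variables (H : set G) (u : V) (chi : G -> F).
Hypotheses (irr : irreducible pi) (sH : is_subgroup H).
Hypotheses (u0 : u != 0) (Hu : forall h, H h -> pi h u = chi h *: u).
Hypothesis impu : imprimitive pi setT H (seq_span [:: u]).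

Let L : set V := seq_span [:: u].
Let R : set V := translate_sum ([set: G] `\` H) L.
Let sL : is_subspace L. Proof. exact: seq_span_subspace. Qed.
Let sR : is_subspace R. Proof. exact: translate_sum_subspace. Qed.
Let Lu : L u. Proof. by apply: seq_span_mem; exact: mem_head. Qed.
Let scaleL c : R (c *: u) -> c = 0.
Proof.
move=> Rcu; have /eqP : c *: u = 0 by apply: impu => //; apply: subspaceZ.
by rewrite scaler_eq0 (negPf u0) orbF => /eqP.
Qed.

Let smL : submodule pi H L.
Proof.
split=> // h w Hh /seq_span1P[c ->]; rewrite linearZZ Hu//.
by apply: subspaceZ => //; apply: subspaceZ.
Qed.

Let spanu v : translate_sum setT L v.
Proof.
have [sS tS] := translate_sum_submodule pi (subgroup_setT G) sL.
have [S0|->//] := irr.2 _ sS (fun g v => tS g v I).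
have : translate_sum setT L u by exact: (translate_sum_sub pi (subgroup_setT G) Lu).
by rewrite S0 => /eqP; rewrite (negPf u0).
Qed.

(** The coefficient of [u] in the decomposition of [V] into the translates of the line
    spanned by [u]. *)
Lemma exists_coordinate : exists eps : V -> F,
  [/\ forall a v w, eps (a *: v + w) = a * eps v + eps w,
    eps u = 1, forall h v, H h -> eps (pi h v) = chi h * eps v &
    forall g, ~ H g -> eps (pi g u) = 0].
Proof.
have /choice[eps epsP] : forall v, exists c, R (v - c *: u).
  move=> v; have [w /seq_span1P[c ->] Rv] := translate_sum_split sH smL (spanu v).
  by exists c.
have epsE v c : R (v - c *: u) -> eps v = c.
  move=> Rc; apply/eqP; rewrite -subr_eq0; apply/eqP/scaleL.
  have -> : (eps v - c) *: u = (v - c *: u) - (v - eps v *: u).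
    by rewrite scalerBl opprB [RHS]addrC addrA subrK.
  exact: subspaceB.
have R0 : R 0 by apply: subspace0.
exists eps; split=> [a v w||h v Hh|g Hg]; apply: epsE.
- by rewrite scalerDl -scalerA opprD addrACA -scalerBr; apply: subspaceZD.
- by rewrite scale1r subrr.
- have -> : pi h v - (chi h * eps v) *: u = pi h (v - eps v *: u).
    by rewrite linearB (linearZZ (pi h)) Hu// scalerA mulrC.
  by apply: translate_sum_setD_stable (epsP v) => //; exact: subgroup_setT.
- by rewrite scale0r subr0; apply: translate_sum_mem.
Qed.

(** The isomorphism sends [v] to the function [x |-> eps (pi x v)]. It is injective as
    [V] is irreducible. It is surjective since [u] goes to the function supported on
    [H] and equal to [chi] there, whose translates span the induced representation. *)
Lemma monomial_of_imprimitive : monomial pi.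
Proof.
have [eps [epsL eps1 epsH eps0]] := exists_coordinate.
have chiM h k : H h -> H k -> chi (h * k)%g = chi h * chi k.
  move=> Hh Hk; have := epsH _ u (subgroupM sH Hh Hk).
  by rewrite repr_funM !epsH// eps1 !mulr1.
have chi0 h : H h -> chi h != 0.
  move=> Hh; apply: contra_neq u0 => c0; apply: (@repr_eq0 _ _ _ pi h).
  by rewrite Hu// c0 scale0r.
have epsD v w : eps (v + w) = eps v + eps w by have := epsL 1 v w; rewrite scale1r mul1r.
have epsz : eps 0 = 0 by apply: (addrI (eps 0)); rewrite -epsD !addr0.
have epsZ c v : eps (c *: v) = c * eps v by rewrite -(addr0 (c *: v)) epsL epsz addr0.
have ind v : (fun x => eps (pi x v) : F^o) \in induced_space H chi.
  rewrite inE; split=> [h g Hh|]; first by rewrite repr_funM epsH.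
  have := spanu v; elim=> [|g w v' _ Lw _ [A [fA sA]]].
    by exists set0; split=> // x /=; rewrite linear0 epsz eqxx.
  exists ([set g^-1%g] `|` A); split; first by rewrite finite_setU.
  move=> x /=; rewrite linearD epsD bigcup_setU bigcup_set1.
  have [e0|e0 _] := eqVneq (eps (pi x (pi g w))) 0.
    by rewrite e0 add0r => /sA; right.
  left; exists (x * g)%g; last by rewrite mulgK.
  apply: contrapT => nH; case/eqP: e0; have [c ->] := (seq_span1P _ _).1 Lw.
  by rewrite -repr_funM linearZZ epsZ eps0// mulr0.
pose phi v : induced H chi := Induced (ind v).
have phi_lin : linear phi.
  move=> a v w; apply: val_inj; apply/funext => x.
  by rewrite /= linearP epsL.
pose phiL : {linear V -> induced H chi} :=
  HB.pack phi (GRing.isLinear.Build _ _ _ _ phi phi_lin).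
exists H, chi; split=> //; exists phiL; split; last first.
  by move=> g v; apply: val_inj; apply/funext => x /=; rewrite repr_funM.
have inj : injective phi.
  suff ker v : phi v = 0 -> v = 0.
    move=> v w phivw; apply/eqP; rewrite -subr_eq0; apply/eqP/ker.
    by have := linearB phiL v w; rewrite /= phivw subrr.
  have [||K0 phiv|KT] := irr.2 [set v | forall x, eps (pi x v) = 0].
  - apply/is_subspaceP; split=> [x|a v' w Kv Kw x]; first by rewrite linear0.
    by rewrite linearP epsL Kv Kw mulr0 addr0.
  - by move=> g v' Kv x; rewrite -repr_funM Kv.
  - have : [set v | forall x, eps (pi x v) = 0] v.
      by move=> x; have := congr1 (fun f : induced H chi => f x) phiv.
    by rewrite K0.
  - have : [set v | forall x, eps (pi x v) = 0] u by rewrite KT.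
    by move=> /(_ 1%g) /eqP; rewrite repr_fun1 eps1 oner_eq0.
have surj : forall f, exists v, phi v = f.
  suff sup (A : seq G) : forall f : induced H chi,
      (forall x, f x != 0 -> exists2 a, a \in A & right_coset H a x) -> exists v, phi v = f.
    move=> f; have := induced_funP f; rewrite inE => -[_ [B [/finite_seqP[A ->] fA]]].
    by apply: (sup A) => x /fA[a Aa Ha]; exists a.
  elim: A => [|a A IHA] f fA.
    exists 0; apply: val_inj; apply/funext => x /=; rewrite linear0 epsz.
    by apply/esym/eqP; case: eqP => // /eqP /fA[].
  have fH h : H h -> f (h * a)%g = chi h * f a.
    by move=> Hh; have := induced_funP f; rewrite inE => -[-> //].
  pose g := f - phi (f a *: pi a^-1%g u).
  have gE x : g x = f x - f a * eps (pi (x * a^-1)%g u).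
    have -> : g x = f x - phi (f a *: pi a^-1%g u) x by [].
    by rewrite /= linearZZ epsZ repr_funM.
  have [x gx|v Ev] := IHA g; last first.
    exists (v + f a *: pi a^-1%g u).
    have := linearD phiL v (f a *: pi a^-1%g u) => /= ->.
    by rewrite Ev /g subrK.
  have nHx : ~ right_coset H a x.
    move=> [h Hh hx]; case/eqP: gx; rewrite gE -hx fH// mulgK Hu//.
    by rewrite epsZ eps1 mulr1 mulrC subrr.
  have fx : f x != 0.
    apply: contra_neq gx => fx; rewrite gE fx eps0 ?mulr0 ?subr0//.
    by move=> Hxa; apply: nHx; exists (x * a^-1)%g; rewrite ?mulgVK.
  have [b] := fA _ fx; rewrite inE => /orP[/eqP->//|Ab Hb]; by exists b.
have /choice[psi psiK] := surj.
by exists psi => // v; apply: inj; rewrite psiK.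
Qed.

End Coordinate.
End FiniteWeightMonomial.

(** * Schur's lemma in countable dimension *)

Section PolyAct.
Variables (F : closedFieldType) (V : lmodType F) (f : {linear V -> V}).

Lemma poly_actD p q v : poly_act f (p + q) v = poly_act f p v + poly_act f q v.
Proof.
pose n := maxn (size p) (size q).
rewrite (poly_act_widen f v (leq_maxl _ _ : (size p <= n)%N)).
rewrite (poly_act_widen f v (leq_maxr _ _ : (size q <= n)%N)).
rewrite (poly_act_widen f v (size_polyD _ _ : (size (p + q)%R <= n)%N)) -big_split.
by apply: eq_bigr => i _; rewrite /= coefD scalerDl.
Qed.

Lemma poly_actC c v : poly_act f c%:P v = c *: v.
Proof.
by rewrite (poly_act_widen f v (size_polyC_leq1 c)) big_ord1 coefC.
Qed.

(** Without eigenvectors no nonzero polynomial in [f] kills [v], so that its partial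
    fractions [w c = (f - c)^-1 v] are independent. The polynomial term [p] makes the
    statement stable under [f - c n], which removes one fraction. *)
Lemma partial_fractions_independent v (w : F -> V) n (c : nat -> F) (a : nat -> F) p :
  v != 0 -> (forall d x, f x = d *: x -> x = 0) ->
  (forall d, f (w d) - d *: w d = v) ->
  (forall i j, (i < n)%N -> (j < n)%N -> c i = c j -> i = j) ->
  poly_act f p v + \sum_(i < n) a i *: w (c i) = 0 ->
  forall i, (i < n)%N -> a i = 0.
Proof.
move=> v0 noeig wP; elim: n a p => // n IHn a p injc sum0.
have tors q : poly_act f q v = 0 -> q = 0.
  move=> qv; apply/eqP; case: eqP => // /eqP q0.
  have [d [r [rv frv]]] := poly_act_eigenvector q0 v0 qv.
  by case/eqP: rv; apply: noeig frv.
have fw d e : f (w d) - e *: w d = v + (d - e) *: w d.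
  by rewrite -(wP d) scalerBl addrA subrK.
have ai i : (i < n)%N -> a i = 0.
  move=> ni.
  have ci : c i - c n != 0.
    rewrite subr_eq0; apply/eqP => /injc -/(_ (ltnW ni) (ltnSn _)) E.
    by rewrite E ltnn in ni.
  apply: (mulIf ci); rewrite mul0r.
  apply: (IHn (fun i => a i * (c i - c n))
    (('X - (c n)%:P) * p + (\sum_(j < n.+1) a j)%:P)) => //.
    by move=> j k /ltnW jn /ltnW kn; apply: injc.
  rewrite poly_actD poly_actC poly_act_XsubC.
  move: sum0; set P := poly_act f p v; set S := \sum_(_ < n.+1) _ => sum0.
  have fS : f S - c n *: S =
      (\sum_(j < n.+1) a j) *: v + \sum_(j < n) (a j * (c j - c n)) *: w (c j).
    rewrite linear_sum scaler_sumr -sumrB scaler_suml.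
    rewrite (eq_bigr (fun j : 'I_n.+1 => a j *: v + (a j * (c j - c n)) *: w (c j))).
      rewrite big_split /=; congr (_ + _).
      by rewrite big_ord_recr /= subrr mulr0 scale0r addr0.
    move=> j _; rewrite linearZZ !scalerA (mulrC (c n)) -!scalerA -scalerBr fw scalerDr.
    by rewrite scalerA.
  by rewrite -addrA -fS addrACA -linearD -opprD -scalerDr sum0 linear0 scaler0 subrr.
move=> i; rewrite ltnS leq_eqVlt => /orP[/eqP->|]; last exact: ai.
move: sum0; rewrite big_ord_recr big1 /=; last first.
  by move=> j _; rewrite ai// scale0r.
rewrite add0r => sum0; have /tors : poly_act f (('X - (c n)%:P) * p + (a n)%:P) v = 0.
  rewrite poly_actD poly_actC poly_act_XsubC.
  move: sum0; set P := poly_act f p v => sum0.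
  rewrite -{1}(wP (c n)) scalerBr -linearZZ scalerA mulrC -scalerA addrACA -linearD.
  by rewrite -opprD -scalerDr sum0 linear0 scaler0 subrr.
by move=> /(congr1 (fun q => q.[c n])); rewrite !hornerE subrr mul0r add0r.
Qed.

End PolyAct.

Section Schur.
Variables (F : closedFieldType) (G : groupType) (V : lmodType F).
Variable pi : representation G V.
Hypothesis uncountableF : ~ countable [set: F].
Hypotheses (irr : irreducible pi) (cdV : countable_dimensional [set: V]).

Lemma countable_exhaustion : exists b : nat -> V,
  forall v, exists n, seq_span [seq b i | i <- iota 0 n] v.
Proof.
have [B [/countable_injP[f injf] [_ spanB]]] := cdV.
pose b n : V := xget 0 [set v | B v /\ f v = n].
exists b; pose S n := seq_span [seq b i | i <- iota 0 n].
have mono m n : (m <= n)%N -> S m `<=` S n.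
  move=> mn; apply: seq_span_min; first exact: seq_span_subspace.
  move=> _ /mapP[k km ->]; apply: seq_span_mem; apply: map_f.
  by move: km; rewrite !mem_iota !add0n => /andP[_ km]; apply: leq_trans mn.
have sU : is_subspace [set v | exists n, S n v].
  apply/is_subspaceP; split; first by exists 0%N.
  move=> a x y [m Sx] [n Sy]; exists (maxn m n); apply: subspaceZD.
  - exact: seq_span_subspace.
  - exact: (mono _ _ (leq_maxl m n)).
  - exact: (mono _ _ (leq_maxr m n)).
have : lin_span B `<=` [set v | exists n, S n v].
  apply: smallest_sub => // v Bv; exists (f v).+1; apply: seq_span_mem.
  apply/mapP; exists (f v); first by rewrite mem_iota /=.
  have [Bb fb] : [set w | B w /\ f w = f v] (b (f v)) by apply: xgetPex; exists v.
  by apply/esym/injf; rewrite ?inE.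
by rewrite spanB => + v; apply.
Qed.

(** Were [f] not a scalar, every [f - c] would be invertible, its kernel and image being
    invariant. The vectors [(f - c)^-1 v0] would then be independent, but they are
    uncountably many, and infinitely many of them would lie in one of countably many
    subspaces of finite dimension. *)
Lemma schur (f : {linear V -> V}) : (forall g v, f (pi g v) = pi g (f v)) ->
  exists c, forall v, f v = c *: v.
Proof.
move=> fpi; apply: contrapT => noc.
have [[v0 v00] simV] := irr.
have fK c : is_subspace [set v | f v = c *: v].
  apply/is_subspaceP; split; first by rewrite /= linear0 scaler0.
  by move=> a x y /= fx fy; rewrite linearP fx fy scalerDr !scalerA mulrC.
have noeig d x : f x = d *: x -> x = 0.
  move=> fx; have [|K0|KT] := simV _ (fK d).
  - by move=> g v /= fv; rewrite fpi fv linearZZ.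
  - by have : [set v | f v = d *: v] x by []; rewrite K0.
  - by case: noc; exists d => v; have : [set v | f v = d *: v] v by rewrite KT.
have /choice[w wP] : forall d, exists x, f x - d *: x = v0.
  move=> d; have [||I0|IT] := simV [set v | exists x, f x - d *: x = v].
  - apply/is_subspaceP; split; first by exists 0; rewrite linear0 scaler0 subr0.
    move=> a _ _ [x <-] [y <-]; exists (a *: x + y); rewrite linearP scalerDr opprD.
    by rewrite addrACA scalerBr !scalerA (mulrC d).
  - by move=> g _ [x <-]; exists (pi g x); rewrite fpi (linearB (pi g)) (linearZZ (pi g)).
  - case/eqP: v00; apply: (noeig d); apply/eqP; rewrite -subr_eq0; apply/eqP.
    have : [set v | exists x, f x - d *: x = v] (f v0 - d *: v0) by exists v0.
    by rewrite I0.
  - by have : [set v | exists x, f x - d *: x = v] v0 by rewrite IT.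
have [b bP] := countable_exhaustion.
pose A n := [set c | seq_span [seq b i | i <- iota 0 n] (w c)].
apply: uncountableF; have -> : [set: F] = \bigcup_(n in setT) A n.
  by apply/seteqP; split=> // c _; have [n wn] := bP (w c); exists n.
apply: bigcup_countable => // n _; apply: finite_set_countable; apply: contrapT.
move=> /(infinite_set_fset n.+1)[X XA nX]; pose s := finmap.enum_fset X.
have st : (size [seq b i | i <- iota 0 n] < n.+1)%N by rewrite size_map size_iota.
have ws i : (i < n.+1)%N -> seq_span [seq b i | i <- iota 0 n] (w s`_i).
  by move=> i_n; apply: XA; apply: mem_nth; apply: leq_trans nX.
have [a [i i_n ai] sum0] := seq_span_dependent (f := fun i => w s`_i) st ws.
case/eqP: ai; apply: (partial_fractions_independent (f := f) (w := w) (n := n.+1)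
  (c := fun i => s`_i) (p := 0) v00 noeig wP) => //; last first.
  by rewrite /poly_act size_poly0 big_ord0 add0r.
move=> j k jn kn /eqP; rewrite nth_uniq ?finmap.fset_uniq//; first by move/eqP.
  exact: leq_trans nX.
exact: leq_trans nX.
Qed.

End Schur.

(** * Irreducible monomial representations have finite weight *)

Section MonomialFiniteWeight.
Variables (F : closedFieldType) (G : groupType) (V : lmodType F).
Variable pi : representation G V.
Hypothesis uncountableF : ~ countable [set: F].
Hypotheses (irr : irreducible pi) (cdV : countable_dimensional [set: V]).

(** The action of the group algebra, whose elements are written as sequences. *)
Definition comb (s : seq (F * G)) v := \sum_(q <- s) q.1 *: pi q.2 v.

Section Frobenius.
Variables (H : set G) (chi : G -> F) (d : V) (eps : V -> F).
Hypothesis sH : is_subgroup H.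
Hypothesis wd : weight_space pi H chi d.
Hypothesis epsL : forall a v w, eps (a *: v + w) = a * eps v + eps w.
Hypotheses (eps1 : eps d = 1) (eps0 : forall g, ~ H g -> eps (pi g d) = 0).

(** Frobenius reciprocity: the only relations satisfied by the translates of the
    generator [d] of an induced representation are those which hold for every vector
    of the same weight. For all the terms of [s] in one coset of [H] together
    contribute a multiple [C] of a single translate of [d], and the coordinate [eps]
    shows that [C] is zero. *)
Lemma comb_eq0 s w : weight_space pi H chi w -> comb s d = 0 -> comb s w = 0.
Proof.
move=> ww; have epsz : eps 0 = 0.
  by have := epsL (-1) 0 0; rewrite scaler0 addr0 mulN1r addNr.
elim: {s}_.+1 {-2}s (ltnSn (size s)) => // n IHn [|[c g] s] sn sd.
  by rewrite /comb big_nil.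
pose P (q : F * G) := `[< H (g^-1 * q.2)%g >].
pose s1 := (c, g) :: s.
pose A := [seq q <- s1 | P q]; pose B := [seq q <- s1 | ~~ P q].
have split v : comb s1 v = comb A v + comb B v by rewrite /comb (bigID P) !big_filter.
pose C := \sum_(q <- A) q.1 * chi (g^-1 * q.2)%g.
have EA v : weight_space pi H chi v -> comb A v = C *: pi g v.
  move=> wv; rewrite /comb /C scaler_suml; apply: eq_big_seq => -[e h].
  rewrite mem_filter /P /= => /andP[/asboolP Hgh _].
  by rewrite -scalerA -(linearZZ (pi g)) -wv// -repr_funM mulVKg.
have eB : eps (pi g^-1%g (comb B d)) = 0.
  rewrite /comb linear_sum /= big_seq; elim/big_ind: _ => //.
    by move=> x y ex ey; rewrite -[x]scale1r epsL ex ey mulr0 addr0.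
  move=> [e h]; rewrite mem_filter /P /= => /andP[/asboolPn nH _].
  by rewrite linearZZ -repr_funM -(addr0 (e *: _)) epsL eps0// mulr0 epsz addr0.
have C0 : C = 0.
  have := congr1 (fun v => eps (pi g^-1%g v)) sd.
  rewrite /= split EA// linearD linearZZ -repr_funM mulVg repr_fun1 epsL eps1 eB.
  by rewrite linear0 epsz mulr1 addr0.
have Bd : comb B d = 0 by move: sd; rewrite split EA// C0 scale0r add0r.
rewrite split EA// C0 scale0r add0r; apply: IHn Bd; apply: leq_ltn_trans (sn : (size s < n)%N).
rewrite /B /= /P /= mulVg; case: asboolP => [_|[]]; last exact: subgroup1.
by rewrite size_filter; exact: count_size.
Qed.

(** By [comb_eq0] an endomorphism of the representation sends [d] to [w], and by Schur's
    lemma it is a scalar. *)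
Lemma weight_space_line w : weight_space pi H chi w -> exists c, w = c *: d.
Proof.
move=> ww; have [[v0 v00] simV] := irr.
have combZD a s t v : comb ([seq (a * q.1, q.2) | q <- s] ++ t) v = a *: comb s v + comb t v.
  rewrite /comb big_cat big_map scaler_sumr; congr (_ + _).
  by apply: eq_bigr => q _; rewrite scalerA.
have combpi g s v : comb [seq (q.1, (g * q.2)%g) | q <- s] v = pi g (comb s v).
  rewrite /comb big_map linear_sum; apply: eq_bigr => q _.
  by rewrite linearZZ repr_funM.
have span x : exists s, x = comb s d.
  have [||S0|ST] := simV [set x | exists s, x = comb s d].
  - apply/is_subspaceP; split; first by exists [::]; rewrite /comb big_nil.
    move=> a _ _ [s ->] [t ->].
    by exists ([seq (a * q.1, q.2) | q <- s] ++ t); rewrite combZD.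
  - by move=> g _ [s ->]; exists [seq (q.1, (g * q.2)%g) | q <- s]; rewrite combpi.
  - have : [set x | exists s, x = comb s d] d.
      by exists [:: (1, 1%g)]; rewrite /comb big_seq1 scale1r repr_fun1.
    rewrite S0 => /= d0; have := eps1; rewrite d0.
    have := epsL (-1) 0 0; rewrite scaler0 addr0 mulN1r addNr => -> /esym/eqP.
    by rewrite oner_eq0.
  - by have : [set x | exists s, x = comb s d] x by rewrite ST.
have [|||||th hth thP] := @hom_of_rel _ _ _ pi setT setT
    (fun x y => exists s, x = comb s d /\ y = comb s w).
- by split; [exact: subspace_setT|].
- move=> a x y x' y' _ _ [s [-> ->]] [t [-> ->]].
  by exists ([seq (a * q.1, q.2) | q <- s] ++ t); rewrite !combZD.
- by move=> g x x' _ _ [s [-> ->]]; exists [seq (q.1, (g * q.2)%g) | q <- s]; rewrite !combpi.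
- by move=> x _; have [s ->] := span x; exists (comb s w), s.
- by move=> x' [s [/esym sd ->]]; apply: comb_eq0 sd.
have th_lin : linear th by move=> a x y; apply: hth.1.
pose thL : {linear V -> V} := HB.pack th (GRing.isLinear.Build _ _ _ _ th th_lin).
have [c thc] := schur uncountableF irr cdV (f := thL) (fun g v => hth.2 g v I I).
exists c; have <- : th d = c *: d := thc d; have [s [sd ->]] := thP d I.
apply/eqP; rewrite -subr_eq0; apply/eqP.
pose t := [seq (-1 * q.1, q.2) | q <- s] ++ [:: (1, 1%g)].
have Et v : comb t v = v - comb s v.
  by rewrite combZD /comb big_seq1 scale1r repr_fun1 scaleN1r addrC.
by rewrite -Et; apply: comb_eq0 => //; rewrite Et -sd subrr.
Qed.

End Frobenius.

(** In the induced representation, the weight space of the inducing character is the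
    line through the function [delta] equal to [chi] on [H] and to zero elsewhere. *)
Lemma finite_weight_of_monomial : monomial pi -> finite_weight pi.
Proof.
move=> [H [chi [sH [chi0 chiM] [phi [[psi phiK psiK] phipi]]]]].
have chi1 : chi 1%g = 1.
  have H1 := subgroup1 sH; apply: (mulfI (chi0 _ H1)).
  by rewrite -chiM// mulg1 mulr1.
have delta_mem : (fun x => if `[< H x >] then chi x else 0 : F^o) \in induced_space H chi.
  rewrite inE; split=> [h g Hh|].
    case: asboolP => Hhg; case: asboolP => Hg; last by rewrite mulr0.
    - exact: chiM.
    - by case: Hg; rewrite -(mulKg h g); apply: (subgroupM sH) => //; apply: (subgroupV sH).
    - by case: Hhg; apply: (subgroupM sH).
  exists [set 1%g]; split; first exact: finite_set1.
  move=> x /=; case: asboolP => Hx; last by rewrite eqxx.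
  by move=> _; rewrite bigcup_set1; exists x; rewrite ?mulg1.
pose delta : induced H chi := Induced delta_mem.
pose d := psi delta; pose eps v : F := (phi v : induced H chi) 1%g.
have phid : phi d = delta by rewrite psiK.
have epsL a v w : eps (a *: v + w) = a * eps v + eps w by rewrite /eps linearP.
have epsd g : eps (pi g d) = delta g by rewrite /eps phipi phid /= mul1g.
have eps1 : eps d = 1.
  rewrite -(repr_fun1 pi d) epsd /=; case: asboolP => [_|[]]; first by rewrite chi1.
  exact: subgroup1.
have eps0 g : ~ H g -> eps (pi g d) = 0 by move=> nHg; rewrite epsd /=; case: asboolP.
have wd : weight_space pi H chi d.
  move=> h Hh; apply: (can_inj phiK); rewrite phipi phid linearZZ phid.
  apply: val_inj; apply/funext => x /=.
  change ((if `[< H (x * h)%g >] then chi (x * h)%g else 0) =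
    chi h * (if `[< H x >] then chi x else 0)).
  case: asboolP => Hxh; case: asboolP => Hx; last by rewrite mulr0.
  - by rewrite chiM// mulrC.
  - by case: Hx; rewrite -(mulgK h x); apply: (subgroupM sH) => //; apply: (subgroupV sH).
  - by case: Hxh; apply: (subgroupM sH).
have d0 : d != 0.
  apply/eqP => d0; have := eps1; rewrite d0 /eps linear0 => /esym/eqP.
  by rewrite oner_eq0.
exists H, chi; split=> //; first by exists d.
exists [set d]; split; first exact: finite_set1.
split.
  move=> s a us sd; case: s us sd => [//|v [|w s]] us sd.
    have -> : v = d by apply: sd; exact: mem_head.
    rewrite big_seq1 => /eqP; rewrite scaler_eq0 (negPf d0) orbF => /eqP ad x.
    by rewrite inE => /eqP ->.
  move: us; have -> : v = d by apply: sd; exact: mem_head.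
  have -> : w = d by apply: sd; rewrite !inE eqxx orbT.
  by rewrite /= inE eqxx.
apply/seteqP; split.
  apply: smallest_sub => [|_ -> //]; apply/is_subspaceP; split.
    by move=> h _; rewrite linear0 scaler0.
  move=> a x y wx wy h Hh; rewrite linearP wx// wy// scalerDr !scalerA.
  by rewrite mulrC.
move=> w /(weight_space_line sH wd epsL eps1 eps0)[c ->] M [sM dM].
by apply: (subspaceZ sM); apply: dM.
Qed.

End MonomialFiniteWeight.

(** A vector [v] in the given weight space spans a module of finite multiplicity. The
    representation is thus induced from some [P]-module [U] of finite dimension, which
    is itself induced from a character. *)
Lemma monomial_of_finite_weight (F : closedFieldType) (G : groupType)
    (V : lmodType F) (pi : representation G V) :
  finitely_generated G -> nilpotent_group G -> irreducible pi ->
  finite_weight pi -> monomial pi.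
Proof.
move=> fgG nilG irr [H [chi [sH _ [v wv v0] fdW]]].
have sL := seq_span_subspace [:: v].
have Lv : seq_span [:: v] v by apply: seq_span_mem; exact: mem_head.
have fm : finite_multiplicity pi H (seq_span [:: v]) (weight_space pi H chi).
  split.
  - split=> [|M [sM _] ML].
      split=> // h w Hh /seq_span1P[c ->]; rewrite linearZZ wv//.
      by do 2?apply: subspaceZ.
    have [[w Mw w0]|/nonzeroPn] := pselect (nonzero M); last by left.
    right; have [c Ew] := (seq_span1P _ _).1 (ML _ Mw).
    have c0 : c != 0 by apply: contraNneq w0 => c0; rewrite Ew c0 scale0r.
    apply: seq_span_min => // x; rewrite inE => /eqP ->.
    by rewrite -[v]scale1r -(mulVf c0) -scalerA -Ew; apply: subspaceZ.
  - by exists v.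
  - by exists [:: v].
  - exact: finite_dimensionalP.
  - move=> th hth u /[dup] Lu /seq_span1P[c Eu] h Hh.
    have hu : pi h u = chi h *: u by rewrite Eu linearZZ wv// !scalerA mulrC.
    have L0 := subspace0 sL; have th0 : th 0 = 0.
      by have := hth.1 (-1) 0 0 L0 L0; rewrite scaler0 addr0 scaleN1r addNr.
    by rewrite -hth.2// hu -(addr0 (_ *: u)) hth.1// th0 addr0.
have [P [U [sP simU nzU fU impU]]] := exists_irreducibly_induced fgG nilG sH fm.
have [K [u [[sK KP] Uu u0 Ku impu]]] := fin_dim_monomial nilG simU.1.1 fU sP simU nzU.
have /choice[psi psiP] : forall h, exists c, K h -> pi h u = c *: u.
  by move=> h; have [/Ku[c hu]|nK] := pselect (K h); [exists c|exists 0].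
apply: (monomial_of_imprimitive irr sK u0 psiP).
have sl := seq_span_subspace [:: u].
apply: (imprimitive_trans sP KP _ sl impu) => //.
have lU : seq_span [:: u] `<=` U.
  by apply: seq_span_min; [exact: simU.1.1|move=> x; rewrite inE => /eqP ->].
rewrite (translate_sum_simple sP simU sl lU)//; exists u => //.
by apply: seq_span_mem; exact: mem_head.
Qed.

(** A countable set of reals has Lebesgue measure zero. *)
Lemma complex_uncountable (R : realType) : ~ countable [set: R[i]].
Proof.
move=> /countable_injP[f injf].
have cR : countable [set: R].
  apply/countable_injP; exists (fun x => f (real_complex R x)) => x y _ _ fxy.
  by have [] : real_complex R x = real_complex R y by apply: injf; rewrite ?inE.
have := lebesgue_measure.countable_lebesgue_measure0 cR.
rewrite -(set_interval.set_itvNyy R) lebesgue_measure.lebesgue_measure_itv /=.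
by [].
Qed.

Theorem theorem1p1 (R : realType) (G : groupType) (V : lmodType R[i])
    (pi : representation G V) :
  finitely_generated G -> nilpotent_group G ->
  irreducible pi -> countable_dimensional [set: V] ->
  monomial pi <-> finite_weight pi.
Proof.
move=> fgG nilG irr cdV; split; last exact: monomial_of_finite_weight.
exact: finite_weight_of_monomial (@complex_uncountable R) irr cdV.
Qed.
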